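(* Let $r\ge 0$ be an integer and let $\Delta$ be a connected, pure $2$-dimensional simplicial complex of genus $0$ embedded in $\mathbb{R}^2$, such that at every interior vertex, no partially interior edge has the same slope as a totally interior edge. If $\Delta$ has only one totally interior edge $\varepsilon=[v_1v_2]$, then $$\alpha(v_1)+\alpha(v_2)+r-1\ \le\ \operatorname{reg} H_0(J_\bullet)\ \le\ \alpha(v_1)+\alpha(v_2)+r,$$ where $\alpha(v)=\left\lfloor \frac{r+1}{k^{0\partial}(v)}\right\rfloor$.
   Context: Let $S=\mathbb{R}[x,y,z]$ with the standard grading. Genus $0$ means that $\Delta$ has no holes. $\Delta_1^\circ$ and $\Delta_0^\circ$ denote the sets of interior edges and interior vertices of $\Delta$ (those not contained in the boundary $\partial\Delta$). An edge is totally interior if both of its endpoints are interior vertices, and partially interior if exactly one endpoint is an interior vertex. For an interior vertex $v$, $k^{0\partial}(v)$ is the number of distinct slopes among the partially interior edges incident to $v$. Embed $\Delta$ in $\mathbb{R}^3$ by $(x,y)\mapsto(x,y,1)$. For an edge $\tau$ let $l_{\hat\tau}\in S$ be a (nonzero) linear form vanishing on the cone $\hat\tau$ of $\tau$ over the origin. Put $J(\tau)=\langle l_{\hat\tau}^{\,r+1}\rangle\subset S$ and, for an interior vertex $v$, $J(v)=\sum_{\tau\ni v}J(\tau)$, the sum over edges $\tau$ containing $v$. The ideal complex is $$J_\bullet:\quad 0\to\bigoplus_{\tau\in\Delta_1^\circ}J(\tau)\xrightarrow{\ \partial\ }\bigoplus_{v\in\Delta_0^\circ}J(v)\to 0,$$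 where $\partial$ is the restriction of the boundary map of the relative simplicial chain complex $C_\bullet(\Delta,\partial\Delta)$ with coefficients in $S$. $H_0(J_\bullet)$ is the cokernel of $\partial$, a graded $S$-module of finite length. For a graded $S$-module $M$ of finite length, $\operatorname{reg}M=\max\{d\ge 0: M_d\ne 0\}$.
   Formalization: The bounds are stated under the added assumption H_0(J) ≠ 0, since reg is undefined for the zero module; e.g. for r=1 and three, resp. two, partial slopes at v1, v2, H_0 = 0 while the claimed lower bound is 1. *)

(* Defs.v *)
From HB Require Import structures.
From mathcomp Require Import all_boot all_order all_algebra.
From mathcomp Require Import mpoly.
From mathcomp Require Import classical_sets reals.
(* Some notations of topology clash with those of mpoly, hence the filter. *)
From mathcomp Require Import -(notations) topology normedtype.

Set Implicit Arguments.
Unset Strict Implicit.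
Unset Printing Implicit Defensive.

Import Order.TTheory GRing.Theory Num.Theory numFieldNormedType.Exports.

Local Open Scope ring_scope.

(* A finite simplicial complex is the set D of its nonempty faces, on the
   vertices 0, ..., n-1; p gives the position of the vertices in the plane. *)

Definition geom_face (R : realType) (n : nat) (p : 'I_n -> 'rV[R]_2)
    (A : {set 'I_n}) : set 'rV[R]_2 :=
  [set q | exists t : 'I_n -> R,
    [/\ forall i, 0 <= t i, \sum_(i in A) t i = 1
      & q = \sum_(i in A) t i *: p i]]%classic.

Definition realization (R : realType) (n : nat) (D : {set {set 'I_n}})
    (p : 'I_n -> 'rV[R]_2) : set 'rV[R]_2 :=
  [set q | exists2 A, A \in D & geom_face p A q]%classic.

Record embedded_complex (R : realType) (n : nat) (D : {set {set 'I_n}})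
    (p : 'I_n -> 'rV[R]_2) : Prop := EmbeddedComplex {
  face_neq0 : finset.set0 \notin D;
  face_sub : forall A B : {set 'I_n},
    A \in D -> B \subset A -> B != finset.set0 -> B \in D;
  face_vertex : forall i : 'I_n, [set i] \in D;
  face_affinely_independent : forall A : {set 'I_n}, A \in D ->
    forall t : 'I_n -> R, \sum_(i in A) t i = 0 ->
    \sum_(i in A) t i *: p i = 0 -> forall i, i \in A -> t i = 0;
  face_meet : forall A B : {set 'I_n}, A \in D -> B \in D ->
    (geom_face p A `&` geom_face p B)%classic = geom_face p (A :&: B)
}.

Definition triangle (n : nat) (D : {set {set 'I_n}}) (T : {set 'I_n}) : bool :=
  (T \in D) && (#|T| == 3).

Definition pure2 (n : nat) (D : {set {set 'I_n}}) : Prop :=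
  D != finset.set0 /\
  forall A, A \in D -> exists2 T : {set 'I_n}, triangle D T & A \subset T.

(* A hole of a compact subset of the plane is a bounded connected component of
   its complement; the complement always has exactly one unbounded component. *)
Definition genus0 (R : realType) (K : set 'rV[R]_2) : Prop :=
  connected (~` K)%classic.

Definition edge (n : nat) (D : {set {set 'I_n}}) (e : {set 'I_n}) : bool :=
  (e \in D) && (#|e| == 2).

(* The boundary of a pure planar complex is the subcomplex generated by the
   edges that lie in exactly one triangle. *)
Definition boundary_edge (n : nat) (D : {set {set 'I_n}}) (e : {set 'I_n})
    : bool :=
  edge D e && (#|[set T | triangle D T && (e \subset T)]| == 1).

Definition interior_edge (n : nat) (D : {set {set 'I_n}}) (e : {set 'I_n})
    : bool :=
  edge D e && ~~ boundary_edge D e.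

Definition interior_vertex (n : nat) (D : {set {set 'I_n}}) (v : 'I_n) : bool :=
  ~~ [exists e : {set 'I_n}, boundary_edge D e && (v \in e)].

Definition totally_interior (n : nat) (D : {set {set 'I_n}}) (e : {set 'I_n})
    : bool :=
  edge D e && [forall v in e, interior_vertex D v].

Definition partially_interior (n : nat) (D : {set {set 'I_n}}) (e : {set 'I_n})
    : bool :=
  edge D e && (#|[set v in e | interior_vertex D v]| == 1).

(* [None] is the slope of vertical lines. *)
Definition slope (R : realType) (a b : 'rV[R]_2) : option R :=
  if a 0 0 == b 0 0 then None else Some ((b 0 1 - a 0 1) / (b 0 0 - a 0 0)).

Definition num_partial_slopes (R : realType) (n : nat) (D : {set {set 'I_n}})
    (p : 'I_n -> 'rV[R]_2) (v : 'I_n) : nat :=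
  size (undup [seq slope (p v) (p w)
              | w <- enum 'I_n & partially_interior D [set v; w]]).

Definition alpha (R : realType) (r n : nat) (D : {set {set 'I_n}})
    (p : 'I_n -> 'rV[R]_2) (v : 'I_n) : nat :=
  (r.+1 %/ num_partial_slopes D p v)%N.

(* The cone over the origin of the face A placed at height 1. *)
Definition cone (R : realType) (n : nat) (p : 'I_n -> 'rV[R]_2)
    (A : {set 'I_n}) : set 'rV[R]_3 :=
  [set u | exists c : R, exists q : 'rV[R]_2,
    [/\ 0 <= c, geom_face p A q & u = c *: row_mx q (1%:M : 'rV[R]_1)]]%classic.

Definition edge_forms (R : realType) (n : nat) (D : {set {set 'I_n}})
    (p : 'I_n -> 'rV[R]_2) (l : {set 'I_n} -> {mpoly R[3]}) : Prop :=
  forall e, edge D e ->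
    [/\ l e != 0, l e \is 1.-homog & forall u, cone p e u -> (l e).@[u 0] = 0].

Definition J_edge (R : realType) (r n : nat) (l : {set 'I_n} -> {mpoly R[3]})
    (e : {set 'I_n}) : set {mpoly R[3]} :=
  [set f | exists g : {mpoly R[3]}, f = g * l e ^+ r.+1]%classic.

Definition J_vertex (R : realType) (r n : nat) (D : {set {set 'I_n}})
    (l : {set 'I_n} -> {mpoly R[3]}) (v : 'I_n) : set {mpoly R[3]} :=
  [set f | exists2 g : {set 'I_n} -> {mpoly R[3]},
    forall e, edge D e -> v \in e -> J_edge r l e (g e)
    & f = \sum_(e : {set 'I_n} | edge D e && (v \in e)) g e]%classic.

(* The direct sum of the J i over the i such that P i, as families indexed by
   all of I that vanish off P. *)
Definition direct_sum (R : realType) (I : finType) (P : pred I)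
    (J : I -> set {mpoly R[3]}) : set {ffun I -> {mpoly R[3]}} :=
  [set f | forall i, if P i then J i (f i) else f i = 0]%classic.

(* The boundary map from 1-chains to 0-chains relative to the boundary of D:
   an edge {u, w} with u < w is sent to [w] - [u], and boundary vertices are
   sent to 0. *)
Definition rel_boundary (R : realType) (n : nat) (D : {set {set 'I_n}})
    (g : {ffun {set 'I_n} -> {mpoly R[3]}}) : {ffun 'I_n -> {mpoly R[3]}} :=
  [ffun v => if interior_vertex D v then
     \sum_(e : {set 'I_n} | interior_edge D e && (v \in e))
       (-1) ^+ [exists w in e, (v < w)%N] * g e
   else 0].

(* The degree d part of H_0(J) is nonzero. The map rel_boundary being
   homogeneous of degree 0, this part is the quotient of the space of the
   homogeneous elements of degree d of the sum of the J(v) by those that are in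
   the image of the sum of the J(e). *)
Definition H0_neq0 (R : realType) (r n : nat) (D : {set {set 'I_n}})
    (l : {set 'I_n} -> {mpoly R[3]}) (d : nat) : Prop :=
  exists f : {ffun 'I_n -> {mpoly R[3]}},
    [/\ direct_sum (interior_vertex D) (J_vertex r D l) f,
        forall v, f v \is d.-homog
      & ~ (@rel_boundary R n D @`
            direct_sum (interior_edge D) (J_edge r l))%classic f].

(* reg M = d, for a graded module M of finite length given by the predicate
   N d := (M_d != 0). Nothing is the regularity of M = 0. *)
Definition is_reg (N : nat -> Prop) (d : nat) : Prop :=
  N d /\ forall k, N k -> (k <= d)%N.

(* Main.v *)
Require Import Defs.
From HB Require Import structures.
From mathcomp Require Import all_boot all_order all_algebra.
From mathcomp Require Import mpoly.
From mathcomp Require Import classical_sets reals.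
From mathcomp Require Import -(notations) topology normedtype.
From mathcomp Require Import boolp zify ring.

Set Implicit Arguments.
Unset Strict Implicit.
Unset Printing Implicit Defensive.

Import Order.TTheory GRing.Theory Num.Theory numFieldNormedType.Exports.

Local Open Scope ring_scope.

(** An edge other than [eps = [v1 v2]] has at most one interior endpoint, so it
    only contributes to the summand of that endpoint. Dividing by these edges
    leaves, up to a shift of degree by [r.+1], the quotient of the polynomial ring
    by [I1 + I2], where [Ii] is the colon ideal by [X ^+ r.+1] of the ideal
    generated by the powers of the forms of the partially interior edges at [vi],
    and [X] is a form of [eps] ([H0_neq0_of_not_glued] and
    [not_glued_of_H0_neq0]).

    Choose forms [Y] and [Z] such that the forms vanishing at [v1] are spanned by
    [X] and [Y], those vanishing at [v2] by [X] and [Z]. The partially interior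
    edges at [v1] have forms proportional to [Y - c *: X], where the distinct
    values of [c] correspond to the [k1] distinct slopes; similarly at [v2].
    So [I1] and [I2] come from ideals of binary forms generated by powers of
    linear forms. By apolarity, a form orthogonal to these powers is divisible by
    powers of linear forms, which yields two facts about the number [k] of slopes.

    - If [r + a + 2 <= k * (a + i + 1)], then [X ^+ a * Y ^+ i] is congruent
      modulo [I1] to monomials of higher degree in [X] ([monomial_reduction]).
    - If [k * i.+1 <= r.+1], the monomials of degree 0 in [X] and [i] in [Y] do
      not occur in the elements of [I1] ([colon_pencil_mcoeff]).

    Let [ai] be the quotient of [r.+1] by [ki]. An interior endpoint of [eps] has
    at least two slopes ([two_partial_slopes]), and then every monomial of degree
    at least [a1 + a2] satisfies the first condition at [v1] or at [v2]
    ([slope_condition]); hence [I1 + I2] contains all forms of such degrees, which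
    is the upper bound. If [a1] or [a2] were 0, the first condition would always
    hold at the corresponding vertex and the module would vanish. Otherwise the
    second fact shows that [Y ^+ a1.-1 * Z ^+ a2.-1] is not in [I1 + I2], which is
    the lower bound. *)

(** * The apolar pairing of univariate polynomials *)

Section Pairing.
Variable R : numFieldType.
Implicit Types (P Q h : {poly R}) (c : R) (d e r : nat).

(** The apolar (transvectant) pairing of two polynomials of degree at most [d],
    written as a polynomial that turns out to be constant. *)
Definition pairing d P Q : {poly R} :=
  \sum_(j < d.+1) (-1) ^+ j *: (P^`(j) * Q^`(d - j)).

Lemma pairingDl d P1 P2 Q : pairing d (P1 + P2) Q = pairing d P1 Q + pairing d P2 Q.
Proof.
rewrite /pairing -big_split; apply: eq_bigr => j _.
by rewrite derivnD mulrDl scalerDr.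
Qed.

Lemma pairingZl d a P Q : pairing d (a *: P) Q = a *: pairing d P Q.
Proof.
rewrite /pairing scaler_sumr; apply: eq_bigr => j _.
by rewrite derivnZ -scalerAl !scalerA mulrC.
Qed.

Lemma pairing_suml d (I : finType) (S : pred I) (F : I -> {poly R}) Q :
  pairing d (\sum_(i | S i) F i) Q = \sum_(i | S i) pairing d (F i) Q.
Proof.
apply: (big_morph (fun P => pairing d P Q)) => [P1 P2|]; first exact: pairingDl.
by rewrite /pairing big1 // => j _; rewrite linear0 mul0r scaler0.
Qed.

(** The derivative of the alternating sum telescopes to
    [P * Q^`(d.+1)] plus or minus [P^`(d.+1) * Q], which vanishes for degree
    reasons. The pairing may therefore be computed at any point, which replaces
    its invariance under translations of the variable. *)
Lemma pairing_const d P Q c : (size P <= d.+1)%N -> (size Q <= d.+1)%N ->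
  pairing d P Q = ((pairing d P Q).[c])%:P.
Proof.
move=> sP sQ; set T := pairing d P Q.
suff T0 : T^`() = 0.
  have sT : (size T <= 1)%N.
    apply/leq_sizeP => -[//|j] _.
    have /polyP/(_ j) := T0; rewrite coef_deriv coef0 => /eqP.
    by rewrite mulrn_eq0 => /eqP.
  by rewrite (size1_polyC sT) hornerC.
rewrite /T /pairing linear_sum /=.
pose u j := (-1) ^+ j *: (P^`(j) * Q^`(d.+1 - j)) : {poly R}.
rewrite (eq_bigr (fun j : 'I_d.+1 => - u j.+1 - - u j)); last first.
  move=> [j /= jd] _; rewrite linearZ /= derivM -!derivnS /u subSS.
  have -> : (d.+1 - j = (d - j).+1)%N by lia.
  by rewrite exprS mulN1r scaleNr !opprK scalerDr.
rewrite -(big_mkord xpredT (fun j => - u j.+1 - - u j)) telescope_sumr //.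
rewrite /u subn0 (derivn_poly0 sP) (derivn_poly0 sQ).
by rewrite mulr0 mul0r !scaler0 !oppr0 addr0.
Qed.

Lemma horner_derivn_XsubC_exp c s h j : (j <= s)%N ->
  ((('X - c%:P) ^+ s * h)^`(j)).[c] = if j == s then h.[c] *+ s`! else 0.
Proof.
elim: s h j => [|s IH] h [|j] // js.
- by rewrite expr0 mul1r derivn0 fact0.
- by rewrite derivn0 hornerM exprS hornerM hornerXsubC subrr !mul0r.
have -> : (('X - c%:P) ^+ s.+1 * h)^`(j.+1)
    = ((('X - c%:P) ^+ s * (h *+ s.+1 + ('X - c%:P) * h^`()))^`(j)).
  rewrite /derivn iterSr; congr iter.
  rewrite derivM deriv_exp derivXsubC mul1r /= exprS -mulr_natl; ring.
rewrite IH // eqSS; case: eqP => // _.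
by rewrite hornerD hornerM hornerXsubC subrr mul0r addr0 hornerMn -mulrnA factS.
Qed.

Lemma horner_derivn_XsubC_exp1 c s j : (j <= s)%N ->
  ((('X - c%:P) ^+ s)^`(j)).[c] = if j == s then s`!%:R else 0.
Proof.
move=> js; have := horner_derivn_XsubC_exp c 1 js.
by rewrite mulr1 hornerC.
Qed.

(** At [c], the first [r.+1] derivatives of [P] vanish and so do the first
    [d - r] derivatives of [Q]; every term of the pairing contains one of them. *)
Lemma pairing_orth d r P Q c : (r <= d)%N ->
  (size P <= d.+1)%N -> (size Q <= d.+1)%N ->
  ('X - c%:P) ^+ r.+1 %| P -> ('X - c%:P) ^+ (d - r) %| Q -> pairing d P Q = 0.
Proof.
move=> rd sP sQ /dvdpP[G PE] /dvdpP[H QE].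
rewrite (pairing_const c sP sQ) /pairing horner_sum big1 // => -[j /= jd] _.
rewrite hornerZ hornerM PE QE [G * _]mulrC [H * _]mulrC.
have [jr|jr] := ltnP j r.+1.
  by rewrite horner_derivn_XsubC_exp ?(ltnW jr)// ltn_eqF// mul0r mulr0.
have -> : ((('X - c%:P) ^+ (d - r) * H)^`(d - j)).[c] = 0.
  by rewrite horner_derivn_XsubC_exp ?ifF //; lia.
by rewrite !mulr0.
Qed.

Lemma horner0_pairing d P Q :
  (pairing d P Q).[0] =
  \sum_(j < d.+1) (-1) ^+ j * (P`_j *+ j`!) * (Q`_(d - j) *+ (d - j)`!).
Proof.
rewrite horner_sum; apply: eq_bigr => j _.
by rewrite hornerZ hornerM !horner_coef0 !coef_derivn !addn0 !ffactnn mulrA.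
Qed.

(** The order of vanishing of [Q] at [c] grows one step at a time: if [Q] is
    [('X - c%:P) ^+ s] times [G], then its pairing with
    [('X - c%:P) ^+ (d - s)] is a nonzero multiple of [G.[c]]. *)
Lemma dvdp_of_pairing_orth d r Q c : (r <= d)%N -> (size Q <= d.+1)%N ->
  (forall j, (j < d - r)%N -> pairing d ('X^j * ('X - c%:P) ^+ r.+1) Q = 0) ->
  ('X - c%:P) ^+ (d - r) %| Q.
Proof.
move=> rd sQ orth.
have sXc h m : (size (h * ('X - c%:P) ^+ m)%R <= size h + m)%N.
  have [->|h0] := eqVneq h 0; first by rewrite mul0r size_poly0.
  by rewrite size_Mmonic ?monic_exp ?monicXsubC// size_exp_XsubC addnS.
have orthh h : (size h <= d - r)%N -> pairing d (h * ('X - c%:P) ^+ r.+1) Q = 0.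
  move=> sh; rewrite -[h]coefK poly_def mulr_suml pairing_suml big1 // => j _.
  by rewrite -scalerAl pairingZl orth ?scaler0 // (leq_trans (ltn_ord j) sh).
suff H s : (s <= d - r)%N -> ('X - c%:P) ^+ s %| Q by exact: H.
elim: s => [|s IH] sd; first by rewrite expr0 dvd1p.
have /dvdpP[G QE] := IH (ltnW sd).
have sP : (size (('X - c%:P) ^+ (d - s)) <= d.+1)%N by rewrite size_exp_XsubC; lia.
have := orthh (('X - c%:P) ^+ (d - s - r.+1)).
rewrite size_exp_XsubC -exprD.
have -> : (d - s - r.+1 + r.+1 = d - s)%N by lia.
have -> // : ((d - s - r.+1).+1 <= d - r)%N by lia.
move=> /(_ isT); move=> /(congr1 (horner^~ c)).
have jP : (d - s < d.+1)%N by lia.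
rewrite horner0 /pairing horner_sum (bigD1 (Ordinal jP)) //=.
rewrite big1 ?addr0; last first.
  move=> [j /= jd] /eqP/val_eqP /= jn.
  rewrite hornerZ hornerM.
  have [jl|jl] := ltnP j (d - s).
    have := horner_derivn_XsubC_exp1 c (ltnW jl).
    by rewrite (negbTE jn) => ->; rewrite mul0r mulr0.
  suff -> : (Q^`(d - j)).[c] = 0 by rewrite !mulr0.
  by rewrite QE [G * _]mulrC horner_derivn_XsubC_exp ?ifF //; lia.
rewrite hornerZ hornerM (horner_derivn_XsubC_exp1 c (leqnn _)) eqxx.
rewrite QE [G * _]mulrC horner_derivn_XsubC_exp; last lia.
have -> : ((d - (d - s))%N == s) by apply/eqP; lia.
move/eqP.
rewrite mulf_eq0 signr_eq0 /= mulf_eq0 pnatr_eq0 !mulrn_eq0 !eqn0Ngt !fact_gt0 /= => G0.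
by rewrite exprSr dvdp_mul ?dvdp_XsubCl.
Qed.

(** At the point 0 the pairing is a nondegenerate bilinear form in the
    coefficients, so that a family with trivial orthogonal spans. *)
Lemma span_of_nondegenerate_pairing d (gens : seq {poly R}) :
  (forall P, P \in gens -> (size P <= d.+1)%N) ->
  (forall Q, (size Q <= d.+1)%N ->
     (forall P, P \in gens -> pairing d P Q = 0) -> Q = 0) ->
  forall P, (size P <= d.+1)%N ->
  exists a : 'I_(size gens) -> R, P = \sum_i a i *: gens`_i.
Proof.
move=> sgens nondeg P sP.
pose A := \matrix_(i < size gens, j < d.+1) (gens`_i)`_j.
have sgi (i : 'I_(size gens)) : (size (gens`_i)%R <= d.+1)%N.
  by apply: sgens; rewrite mem_nth.
have Afull : row_full A.
  rewrite /row_full -mxrank_tr -[_ == _]/(row_free _) -kermx_eq0; apply/rowV0P => u /sub_kermxP uA.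
  pose w j : R := (-1) ^+ j * j`!%:R * (d - j)`!%:R.
  have w0 j : w j != 0.
    by rewrite /w !mulf_neq0 ?signr_eq0 ?pnatr_eq0 -?lt0n ?fact_gt0.
  pose Q := \poly_(m < d.+1) (u 0 (inord (d - m)) / w (d - m)%N).
  have sQ : (size Q <= d.+1)%N by exact: size_poly.
  have QE (j : 'I_d.+1) : Q`_(d - j) = u 0 j / w j.
    rewrite coef_poly ifT; last lia.
    have -> : (d - (d - j) = j)%N by have := ltn_ord j; lia.
    by rewrite inord_val.
  have /polyP Q0 : Q = 0.
    apply: nondeg => // P' /(nthP 0)[i ig <-].
    rewrite (pairing_const 0 (sgi (Ordinal ig)) sQ) horner0_pairing /=.
    have /rowP/(_ (Ordinal ig)) := uA; rewrite !mxE => uA0.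
    rewrite -[X in _ = X%:P]uA0; congr (_ %:P); apply: eq_bigr => j _.
    rewrite !mxE QE /= -[X in _ * X]mulr_natr -(mulr_natr _`_j) mulrAC.
    transitivity (w j * (u 0 j / w j) * gens`_i`_j); first by rewrite /w; ring.
    by congr (_ * _); rewrite mulrC divfK.
  apply/rowP => j; have := Q0 (d - j)%N; rewrite QE coef0 mxE => /eqP.
  by rewrite mulf_eq0 invr_eq0 (negbTE (w0 j)) orbF => /eqP.
have /submxP[B PE] : (\row_(j < d.+1) P`_j <= A)%MS by apply: submx_full.
exists (fun i => B 0 i); apply/polyP => m.
have [md|md] := ltnP m d.+1; last first.
  rewrite nth_default ?(leq_trans sP)// coef_sum big1 // => i _.
  by rewrite coefZ nth_default ?mulr0 // (leq_trans (sgi i)).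
move/rowP/(_ (Ordinal md)): PE; rewrite !mxE /= => ->.
by rewrite coef_sum; apply: eq_bigr => i _; rewrite coefZ mxE.
Qed.

(** * Powers of linear polynomials with given roots *)

Section Pencil.
Variables (I : finType) (S : pred I) (c : I -> R).

Definition num_values : nat := size (undup [seq c i | i <- enum S]).

Definition values_poly e : {poly R} :=
  \prod_(a <- undup [seq c i | i <- enum S]) ('X - a%:P) ^+ e.

Lemma values_poly_monic e : values_poly e \is monic.
Proof. by rewrite monic_prod // => a _; rewrite monic_exp ?monicXsubC. Qed.

Lemma size_values_poly e : size (values_poly e) = (num_values * e).+1.
Proof.
rewrite /values_poly /num_values; elim: undup => [|a s IH].
  by rewrite big_nil size_poly1.
rewrite big_cons size_monicM ?monic_exp ?monicXsubC //; last first.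
  by rewrite -size_poly_eq0 IH.
by rewrite IH size_exp_XsubC /=; lia.
Qed.

Lemma dvdp_values_poly e i : S i -> ('X - (c i)%:P) ^+ e %| values_poly e.
Proof.
move=> Si; rewrite /values_poly (big_rem (c i)) /=; first by rewrite dvdp_mulr.
by rewrite mem_undup map_f // mem_enum.
Qed.

Lemma values_poly_dvdp e Q :
  (forall i, S i -> ('X - (c i)%:P) ^+ e %| Q) -> values_poly e %| Q.
Proof.
move=> dQ; rewrite /values_poly.
have : {in undup [seq c i | i <- enum S], forall a, ('X - a%:P) ^+ e %| Q}.
  by move=> a; rewrite mem_undup => /mapP[i]; rewrite mem_enum => Si ->; apply: dQ.
have := undup_uniq [seq c i | i <- enum S].
elim: undup => [|a s IH] /=; first by rewrite big_nil dvd1p.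
case/andP=> as_ us ds; rewrite big_cons Gauss_dvdp; last first.
  rewrite big_seq; apply: (big_ind (coprimep _)) => [|x y|b bs].
  - exact: coprimep1.
  - by rewrite coprimepMr => -> ->.
  apply/coprimep_expl/coprimep_expr; rewrite coprimep_XsubC root_XsubC.
  by apply: contraNneq as_ => <-.
rewrite ds ?mem_head //= IH // => b bs; apply: ds; exact: mem_behead.
Qed.

(** A polynomial orthogonal to all the multiples of the powers
    [('X - (c j)%:P) ^+ r.+1] is divisible by the product of the
    [('X - a%:P) ^+ (d - r)] over the distinct values [a] of [c]. If it is also
    orthogonal to the monomials of degree less than [i], its degree is at most
    [d - i]. The numerical hypothesis leaves only the zero polynomial. *)
Lemma pencil_powers_span d r i (P : {poly R}) : (r <= d)%N ->
  (d < num_values * (d - r) + i)%N -> (size P <= d.+1)%N ->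
  exists h : I -> {poly R}, exists q : {poly R},
    [/\ forall j, (size (h j) <= d - r)%N, (size q <= i)%N
      & P = \sum_(j | S j) h j * ('X - (c j)%:P) ^+ r.+1 + q].
Proof.
move=> rd kd sP.
have [id|id] := ltnP i d.+1; last first.
  exists (fun=> 0), P; split; [by move=> j; rewrite size_poly0|exact: leq_trans id|].
  by rewrite big1 ?add0r // => j _; rewrite mul0r.
pose gens := [seq 'X^m * ('X - (c j)%:P) ^+ r.+1 | j <- enum S, m <- iota 0 (d - r)]
             ++ [seq 'X^m | m <- iota 0 i].
have sz m a : size ('X^m * ('X - a%:P) ^+ r.+1 : {poly R}) = (m + r.+2)%N.
  by rewrite size_monicM ?monicXn ?monic_neq0 ?monic_exp ?monicXsubC //
     size_exp_XsubC size_polyXn; lia.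
have [||a ->] := @span_of_nondegenerate_pairing d gens _ _ P sP.
- move=> G; rewrite mem_cat => /orP[/allpairsP[[j m] /= [_ + ->]]|/mapP[m + ->]].
    by rewrite mem_iota sz; lia.
  by rewrite mem_iota size_polyXn; lia.
- move=> Q sQ orth; apply/eqP; apply: contraT => Q0.
  have dQ : values_poly (d - r) %| Q.
    apply: values_poly_dvdp => j Sj; apply: dvdp_of_pairing_orth => // m md.
    apply: orth; rewrite mem_cat; apply/orP; left.
    by apply/allpairsP; exists (j, m); rewrite /= mem_enum mem_iota.
  have := dvdp_leq Q0 dQ; rewrite size_values_poly => kQ.
  suff sQi : (size Q <= d.+1 - i)%N.
    by have := leq_trans kQ sQi; move: kd; set K := (_ * _)%N; lia.
  apply/leq_sizeP => m md.
  have [md'|md'] := ltnP m d.+1; last by rewrite nth_default // (leq_trans sQ).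
  have mi : (d - m < i)%N by lia.
  have : pairing d 'X^(d - m) Q = 0.
    apply: orth; rewrite mem_cat; apply/orP; right.
    by apply/mapP; exists (d - m)%N; rewrite ?mem_iota.
  move=> /(congr1 (horner^~ 0)); rewrite horner0 horner0_pairing.
  have dm : (d - m < d.+1)%N by lia.
  rewrite (bigD1 (Ordinal dm)) //= big1 ?addr0; last first.
    move=> j /negbTE jn; rewrite coefXn.
    have -> : (j == (d - m)%N :> nat) = false by exact: jn.
    by rewrite mul0rn mulr0 mul0r.
  rewrite coefXn eqxx; have -> : (d - (d - m) = m)%N by lia.
  move/eqP; rewrite !mulf_eq0 signr_eq0 !mulrn_eq0 !eqn0Ngt !fact_gt0 /=.
  by rewrite oner_eq0 => /eqP.
have {sP kd} : forall G, G \in gens -> exists h : I -> {poly R}, exists q : {poly R},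
    [/\ forall j, (size (h j) <= d - r)%N, (size q <= i)%N
      & G = \sum_(j | S j) h j * ('X - (c j)%:P) ^+ r.+1 + q].
  move=> G; rewrite mem_cat => /orP[/allpairsP[[j m] /= [+ + ->]]|/mapP[m + ->]].
    rewrite mem_enum mem_iota => Sj mr.
    exists (fun j' => if j' == j then 'X^m else 0), 0; split.
    - by move=> j'; case: ifP => _; rewrite ?size_poly0 ?size_polyXn.
    - by rewrite size_poly0.
    rewrite (bigD1 j) //= eqxx big1 ?addr0 // => j' /andP[_ /negbTE ->].
    by rewrite mul0r.
  rewrite mem_iota => mi; exists (fun=> 0), 'X^m; split.
  - by move=> j; rewrite size_poly0.
  - by rewrite size_polyXn.
  by rewrite big1 ?add0r // => j _; rewrite mul0r.
move=> gensP.
apply: (big_ind (fun G : {poly R} => exists h : I -> {poly R}, exists q : {poly R},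
    [/\ forall j, (size (h j) <= d - r)%N, (size q <= i)%N
      & G = \sum_(j | S j) h j * ('X - (c j)%:P) ^+ r.+1 + q])).
- exists (fun=> 0), 0; split; rewrite ?size_poly0 // big1 ?addr0 // => j _.
  by rewrite mul0r.
- move=> _ _ [h [q [sh sq ->]]] [h' [q' [sh' sq' ->]]].
  exists (fun j => h j + h' j), (q + q'); split.
  + by move=> j; rewrite (leq_trans (size_polyD _ _)) // geq_max sh sh'.
  + by rewrite (leq_trans (size_polyD _ _)) // geq_max sq sq'.
  by rewrite addrACA -big_split; congr (_ + _); apply: eq_bigr => j _; rewrite mulrDl.
move=> j _; have [h [q [sh sq ->]]] := gensP _ (mem_nth 0 (ltn_ord j)).
exists (fun j' => a j *: h j'), (a j *: q); split.
- by move=> j'; rewrite (leq_trans (size_scale_leq _ _)).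
- by rewrite (leq_trans (size_scale_leq _ _)).
rewrite scalerDr scaler_sumr; congr (_ + _); apply: eq_bigr => j' _.
by rewrite -scalerAl.
Qed.

(** The polynomial [Q] of the proof, of degree [r.+1], is orthogonal to the right-hand
    side, while its pairing with [q] sees only the leading coefficient of [q]. *)
Lemma pencil_powers_indep e r (h : I -> {poly R}) (q : {poly R}) :
  (num_values * e.+1 <= r.+1)%N ->
  (forall j, (size (h j) <= e.+1)%N) -> (size q <= e.+1)%N ->
  q = \sum_(j | S j) h j * ('X - (c j)%:P) ^+ r.+1 -> q`_e = 0.
Proof.
move=> ke sh sq qE.
pose d := (e + r.+1)%N.
pose Q := values_poly e.+1 * 'X^(r.+1 - num_values * e.+1).
have monQ : Q \is monic by rewrite monicMl ?monicXn ?values_poly_monic.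
have sQ : size Q = r.+2.
  rewrite size_monicM ?values_poly_monic ?monic_neq0 ?monicXn //.
  by rewrite size_values_poly size_polyXn; lia.
have : pairing d q Q = 0.
  rewrite qE pairing_suml big1 // => j Sj.
  apply: (@pairing_orth _ r _ _ (c j)); rewrite ?sQ /d; [lia| |lia| |].
  - have [->|h0] := eqVneq (h j) 0; first by rewrite mul0r size_poly0.
    rewrite size_Mmonic ?monic_exp ?monicXsubC// size_exp_XsubC.
    by have := sh j; lia.
  - exact: dvdp_mull.
  have -> : (e + r.+1 - r = e.+1)%N by lia.
  by rewrite /Q dvdp_mulr // dvdp_values_poly.
move=> /(congr1 (horner^~ 0)); rewrite horner0 horner0_pairing.
have ed : (e < d.+1)%N by rewrite /d; lia.
rewrite (bigD1 (Ordinal ed)) //= big1 ?addr0; last first.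
  move=> [j /= jd] /eqP/val_eqP /= jn.
  have [je|je] := ltnP j e; last first.
    by rewrite (@nth_default _ _ q) ?mul0rn ?mulr0 ?mul0r // (leq_trans sq) //; lia.
  by rewrite (@nth_default _ _ Q) ?mul0rn ?mulr0 // sQ /d; lia.
have -> : (d - e = r.+1)%N by rewrite /d; lia.
have -> : Q`_r.+1 = 1 by have := monQ; rewrite monicE lead_coefE sQ => /eqP.
move/eqP; rewrite !mulf_eq0 signr_eq0 !mulrn_eq0 oner_eq0 !eqn0Ngt !fact_gt0 /=.
by rewrite orbF => /eqP.
Qed.

End Pencil.
End Pairing.

(** * Ideals of powers in a pencil of linear forms *)

Section PowersIdeal.
Variables (R : fieldType) (A : comAlgType R) (I : finType).
Implicit Types (S : pred I) (L : I -> A) (r : nat) (f g x : A).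

Definition powers_ideal S L r f : Prop :=
  exists B : I -> A, f = \sum_(i | S i) B i * L i ^+ r.+1.

Lemma powers_ideal0 S L r : powers_ideal S L r 0.
Proof. by exists (fun=> 0); rewrite big1 // => i _; rewrite mul0r. Qed.

Lemma powers_idealD S L r f g :
  powers_ideal S L r f -> powers_ideal S L r g -> powers_ideal S L r (f + g).
Proof.
move=> [B ->] [C ->]; exists (fun i => B i + C i).
by rewrite -big_split; apply: eq_bigr => i _; rewrite mulrDl.
Qed.

Lemma powers_idealMl S L r f x :
  powers_ideal S L r f -> powers_ideal S L r (x * f).
Proof.
move=> [B ->]; exists (fun i => x * B i); rewrite mulr_sumr.
by apply: eq_bigr => i _; rewrite mulrA.
Qed.

Lemma powers_idealZ S L r f a :
  powers_ideal S L r f -> powers_ideal S L r (a *: f).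
Proof. by move=> Lf; rewrite -mulr_algl; apply: powers_idealMl. Qed.

Lemma powers_ideal_scale S L L' (b : I -> R) r f :
  (forall i, S i -> b i != 0) -> (forall i, S i -> L i = b i *: L' i) ->
  powers_ideal S L r f <-> powers_ideal S L' r f.
Proof.
move=> b0 LE; split=> -[B ->].
  exists (fun i => b i ^+ r.+1 *: B i); apply: eq_bigr => i Si.
  by rewrite LE // exprZn -scalerAr -scalerAl.
exists (fun i => b i ^- r.+1 *: B i); apply: eq_bigr => i Si.
by rewrite LE // exprZn -scalerAr -scalerAl scalerA divff ?scale1r // expf_neq0 ?b0.
Qed.

End PowersIdeal.

Section Homogenization.
Variables (R : numFieldType) (A : comAlgType R) (X Y : A).

Definition bihomogenize d (P : {poly R}) : A :=
  \sum_(j < d.+1) P`_j *: (X ^+ (d - j) * Y ^+ j).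

Lemma bihomogenize_mul_linear d (P : {poly R}) a : (size P <= d.+1)%N ->
  bihomogenize d.+1 (P * ('X - a%:P)) = bihomogenize d P * (Y - a *: X).
Proof.
move=> sP; pose Q := a *: P.
have -> : P * ('X - a%:P) = P * 'X - Q by rewrite mulrBr [P * _%:P]mulrC mul_polyC.
have -> : bihomogenize d.+1 (P * 'X - Q)
    = bihomogenize d.+1 (P * 'X) - bihomogenize d.+1 Q.
  rewrite /bihomogenize -sumrB; apply: eq_bigr => j _.
  by rewrite coefB scalerBl.
rewrite mulrBr; congr (_ - _).
  rewrite /bihomogenize big_ord_recl coefMX /= scale0r add0r mulr_suml.
  apply: eq_bigr => j _; rewrite coefMX /= /bump /= add1n subSS exprSr.
  by rewrite -scalerAl mulrA.
rewrite /bihomogenize big_ord_recr /= nth_default ?scale0r ?addr0; last first.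
  exact: leq_trans (size_scale_leq _ _) sP.
rewrite mulr_suml; apply: eq_bigr => j _.
rewrite coefZ -scalerAl -scalerAr scalerA [P`_j * a]mulrC; congr (_ *: _).
rewrite subSn; last by have := ltn_ord j; lia.
by rewrite exprS; ring.
Qed.

Lemma bihomogenize_mul_power d s (P : {poly R}) a : (size P <= d.+1)%N ->
  bihomogenize (d + s) (P * ('X - a%:P) ^+ s) = bihomogenize d P * (Y - a *: X) ^+ s.
Proof.
move=> sP; elim: s => [|s IH]; first by rewrite !expr0 !mulr1 addn0.
rewrite addnS !exprSr !mulrA bihomogenize_mul_linear ?IH //.
have [->|P0] := eqVneq P 0; first by rewrite mul0r size_poly0.
by rewrite size_Mmonic ?monic_exp ?monicXsubC // size_exp_XsubC; lia.
Qed.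

Lemma bihomogenizeXn d j : (j <= d)%N -> bihomogenize d 'X^j = X ^+ (d - j) * Y ^+ j.
Proof.
rewrite -ltnS => jd; rewrite /bihomogenize (bigD1 (Ordinal jd)) //= big1 ?addr0.
  by rewrite coefXn eqxx scale1r.
move=> i /eqP/val_eqP /= /negbTE ij; by rewrite coefXn ij scale0r.
Qed.

(** With [k] the number of distinct values of [c], the numerical hypothesis reads
    [k * (d - r) + i > d] for [d = r.+1 + a + i], and the statement is the
    homogenization of [pencil_powers_span] for ['X^i]. It says that, after
    division by [X ^+ r.+1], the monomial [X ^+ a * Y ^+ i] is congruent to
    monomials of higher degree in [X]. *)
Lemma monomial_reduction (I : finType) (S : pred I) (c : I -> R) r a i :
  (r + a + 2 <= num_values S c * (a + i + 1))%N ->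
  exists (q : nat -> R) (f : A), powers_ideal S (fun j => Y - c j *: X) r f /\
    X ^+ (r.+1 + a) * Y ^+ i
      = f + \sum_(m < i) q m *: (X ^+ (r.+1 + a + i - m) * Y ^+ m).
Proof.
move=> cond; pose d := (r.+1 + a + i)%N.
have dr : (d - r = (a + i).+1)%N by rewrite /d; lia.
have [||| h [q [sh sq XiE]]] := @pencil_powers_span R I S c d r i 'X^i.
- by rewrite /d; lia.
- by rewrite dr -addn1; move: cond; set K := (_ * _)%N; rewrite /d; lia.
- by rewrite size_polyXn /d; lia.
exists (fun m => q`_m), (\sum_(j | S j) bihomogenize (a + i) (h j) * (Y - c j *: X) ^+ r.+1).
split; first by exists (fun j => bihomogenize (a + i) (h j)).
have -> : X ^+ (r.+1 + a) * Y ^+ i = bihomogenize d 'X^i.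
  by rewrite bihomogenizeXn /d ?addnK //; lia.
rewrite XiE.
have -> : bihomogenize d (\sum_(j | S j) h j * ('X - (c j)%:P) ^+ r.+1 + q)
  = \sum_(j | S j) bihomogenize d (h j * ('X - (c j)%:P) ^+ r.+1) + bihomogenize d q.
  rewrite /bihomogenize exchange_big -big_split; apply: eq_bigr => m _ /=.
  by rewrite coefD coef_sum scalerDl scaler_suml.
congr (_ + _).
  apply: eq_bigr => j _.
  have -> : d = (a + i + r.+1)%N by rewrite /d; lia.
  by rewrite bihomogenize_mul_power // -dr.
have id : (i <= d.+1)%N by rewrite /d; lia.
rewrite (big_ord_widen _ (fun m => q`_m *: (X ^+ (d - m) * Y ^+ m)) id).
rewrite big_mkcond /=; apply: eq_bigr => m _; case: ltnP => // im.
by rewrite nth_default ?scale0r // (leq_trans sq).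
Qed.

End Homogenization.


(** * Sums of two colon ideals *)

Section ColonSum.
Variables (R : numFieldType) (A : comAlgType R).

(** Membership in the sum of the colon ideals [J1 : x] and [J2 : x]. *)
Definition colon_sum (J1 J2 : A -> Prop) (x g : A) : Prop :=
  exists g1 g2 : A, [/\ g = g1 + g2, J1 (g1 * x) & J2 (g2 * x)].

Variables (I : finType) (S1 S2 : pred I) (L1 L2 : I -> A) (r : nat) (x : A).

Local Notation T := (colon_sum (powers_ideal S1 L1 r) (powers_ideal S2 L2 r) x).

Lemma colon_sumD g h : T g -> T h -> T (g + h).
Proof.
move=> [g1 [g2 [-> J1g J2g]]] [h1 [h2 [-> J1h J2h]]].
exists (g1 + h1), (g2 + h2); split; first by rewrite addrACA.
  by rewrite mulrDl; apply: powers_idealD.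
by rewrite mulrDl; apply: powers_idealD.
Qed.

Lemma colon_sumZ a g : T g -> T (a *: g).
Proof.
move=> [g1 [g2 [-> J1g J2g]]]; exists (a *: g1), (a *: g2).
by rewrite -!scalerAl scalerDr; split => //; apply: powers_idealZ.
Qed.

Lemma colon_sum0 : T 0.
Proof.
by exists 0, 0; rewrite addr0 mul0r; split => //; apply: powers_ideal0.
Qed.

End ColonSum.

(** Each step of [monomial_reduction] trades [Y] or [Z] for [X], so it is an
    induction on the degree in [Y] and [Z]. *)
Lemma monomials_in_colon_sum (R : numFieldType) (A : comAlgType R) (I : finType)
    (S1 S2 : pred I) (c1 c2 : I -> R) (X Y Z : A) (r e : nat) :
  (forall a i j, (a + i + j = e)%N ->
     (r + a + 2 <= num_values S1 c1 * (a + i + 1))%N \/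
     (r + a + 2 <= num_values S2 c2 * (a + j + 1))%N) ->
  forall a i j, (a + i + j = e)%N ->
  colon_sum (powers_ideal S1 (fun m => Y - c1 m *: X) r)
            (powers_ideal S2 (fun m => Z - c2 m *: X) r)
            (X ^+ r.+1) (X ^+ a * Y ^+ i * Z ^+ j).
Proof.
set T := colon_sum _ _ _; move=> cond.
have T0 : T 0 by exact: colon_sum0.
have TD g h : T g -> T h -> T (g + h) by exact: colon_sumD.
have TZ s g : T g -> T (s *: g) by exact: colon_sumZ.
suff H n a i j : (i + j < n)%N -> (a + i + j = e)%N -> T (X ^+ a * Y ^+ i * Z ^+ j).
  by move=> a i j; apply: H (leqnn _).
elim: n a i j => [//|n IH] a i j ijn aije.
have Tsum k (F : 'I_k -> A) : (forall m, T (F m)) -> T (\sum_m F m).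
  by move=> TF; apply: (big_ind T).
have Xsplit k m : (m < k)%N -> X ^+ (r.+1 + a + k - m) = X ^+ (a + k - m) * X ^+ r.+1.
  by move=> mk; rewrite -exprD; congr (_ ^+ _); lia.
have [/(@monomial_reduction R A X Y)|/(@monomial_reduction R A X Z)] := cond _ _ _ aije.
- move=> [q [f [Jf E]]].
  pose t := \sum_(m < i) q m *: (X ^+ (a + i - m) * Y ^+ m * Z ^+ j).
  rewrite -[X ^+ a * _ * _](subrK t); apply: TD; last first.
    by apply: Tsum => m; apply/TZ/IH; have := ltn_ord m; lia.
  exists (X ^+ a * Y ^+ i * Z ^+ j - t), 0; rewrite addr0 mul0r.
  split=> //; last exact: powers_ideal0.
  rewrite (_ : _ * _ = Z ^+ j * f); first exact: powers_idealMl.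
  have -> : f = X ^+ (r.+1 + a) * Y ^+ i
      - \sum_(m < i) q m *: (X ^+ (r.+1 + a + i - m) * Y ^+ m) by rewrite E addrK.
  rewrite mulrBl mulrBr exprD; congr (_ - _); first by ring.
  rewrite /t mulr_suml mulr_sumr; apply: eq_bigr => m _.
  by rewrite Xsplit // -scalerAl -scalerAr; congr (_ *: _); ring.
move=> [q [f [Jf E]]].
pose t := \sum_(m < j) q m *: (X ^+ (a + j - m) * Y ^+ i * Z ^+ m).
rewrite -[X ^+ a * _ * _](subrK t); apply: TD; last first.
  by apply: Tsum => m; apply/TZ/IH; have := ltn_ord m; lia.
exists 0, (X ^+ a * Y ^+ i * Z ^+ j - t); rewrite add0r mul0r.
split=> //; first exact: powers_ideal0.
rewrite (_ : _ * _ = Y ^+ i * f); first exact: powers_idealMl.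
have -> : f = X ^+ (r.+1 + a) * Z ^+ j
    - \sum_(m < j) q m *: (X ^+ (r.+1 + a + j - m) * Z ^+ m) by rewrite E addrK.
rewrite mulrBl mulrBr exprD; congr (_ - _); first by ring.
rewrite /t mulr_suml mulr_sumr; apply: eq_bigr => m _.
by rewrite Xsplit // -scalerAl -scalerAr; congr (_ *: _); ring.
Qed.

(** Put [u = r.+1 %/ k1] and [v = r.+1 %/ k2]. Since [k * (r.+1 %/ k).+1 > r.+1],
    and [k1], [k2] are at least 2, the first alternative holds as soon as
    [u - i <= a / 2], the second one as soon as [v - j <= a / 2]; both cannot
    fail, as [u - i + (v - j) <= a]. *)
Lemma slope_condition (r k1 k2 a i j : nat) : (1 < k1)%N -> (1 < k2)%N ->
  (r.+1 %/ k1 + r.+1 %/ k2 <= a + i + j)%N ->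
  (r + a + 2 <= k1 * (a + i + 1))%N \/ (r + a + 2 <= k2 * (a + j + 1))%N.
Proof.
move=> k1gt k2gt.
have bound k : (1 < k)%N -> (r.+2 <= k * (r.+1 %/ k).+1)%N.
  by move=> kgt; rewrite mulnC ltn_ceil // ltnW.
move: (bound k1 k1gt) (bound k2 k2gt).
set u := (_ %/ k1)%N; set v := (_ %/ k2)%N => b1 b2 uv.
have suff_l k w m : (1 < k)%N -> (r.+2 <= k * w.+1)%N ->
    (w <= m + a %/ 2)%N -> (r + a + 2 <= k * (a + m + 1))%N.
  move=> kgt bw wm.
  have : (k * w.+1 + 2 * (a - a %/ 2) <= k * (a + m + 1))%N.
    rewrite (@leq_trans (k * w.+1 + k * (a - a %/ 2)))%N ?leq_add2l ?leq_mul2r ?kgt ?orbT //.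
    by rewrite -mulnDr leq_mul2l; apply/orP; right; lia.
  by lia.
have [ui|iu] := leqP u i; first by left; apply: suff_l b1 _ => //; lia.
have [vj|jv] := leqP v j; first by right; apply: suff_l b2 _ => //; lia.
have [h|h] := leqP (u + j)%N (v + i)%N.
  by left; apply: suff_l b1 _ => //; lia.
by right; apply: suff_l b2 _ => //; lia.
Qed.

(** Expanding the variables one at a time in terms of [X], [Y] and [Z] turns a
    monomial into a combination of monomials in these forms. The induction on the
    degree keeps [T] general: each step moves a factor from the polynomial into
    the predicate. *)
Lemma homog_ind (R : numFieldType) n (X Y Z : {mpoly R[n]}) (e : nat)
    (T : {mpoly R[n]} -> Prop) :
  (forall i : 'I_n, exists a b c : R, 'X_i = a *: X + b *: Y + c *: Z) ->
  T 0 -> (forall f g, T f -> T g -> T (f + g)) ->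
  (forall (s : R) f, T f -> T (s *: f)) ->
  (forall a i j, (a + i + j = e)%N -> T (X ^+ a * Y ^+ i * Z ^+ j)) ->
  forall f, f \is e.-homog -> T f.
Proof.
move=> span T0 TD TZ TXYZ f /dhomogP hf.
have Tmon : forall m : 'X_{1..n}, mdeg m = e -> T 'X_[m].
  move: {f hf} e T T0 TD TZ TXYZ; elim=> [|e IH] T T0 TD TZ TXYZ m.
    by move=> /eqP; rewrite mdeg_eq0 => /eqP ->; have := TXYZ 0 0 0 erefl;
      rewrite !expr0 !mulr1 mpolyX0.
  move=> mE.
  have [i mi] : exists i, (0 < m i)%N.
    apply/existsP; apply: contraT; rewrite negb_exists => /forallP m0.
    suff : mdeg m = 0 by rewrite mE.
    by rewrite mdegE big1 // => i _; apply/eqP; have := m0 i; rewrite lt0n negbK.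
  have Um : (U_(i) <= m)%MM.
    by apply/mnm_lepP => j; rewrite mnm1E; case: eqP => // <-.
  have m'E : mdeg (m - U_(i))%MM = e.
    by have := mE; rewrite -{1}(submK Um) mdegD mdeg1 addn1 => -[].
  have -> : m = (U_(i) + (m - U_(i)))%MM by rewrite addmC submK.
  rewrite mpolyXD; have [a [b [c ->]]] := span i.
  rewrite !mulrDl -!scalerAl.
  have step W : (forall a i j, (a + i + j = e)%N -> T (W * (X ^+ a * Y ^+ i * Z ^+ j))) ->
      forall s : R, T (s *: (W * 'X_[(m - U_(i))%MM])).
    move=> TW s; apply/TZ; apply: (IH (fun f => T (W * f))) => //.
    - by rewrite mulr0.
    - by move=> f g Tf Tg; rewrite mulrDr; apply: TD.
    - by move=> t f Tf; rewrite -scalerAr; apply: TZ.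
  apply/TD; [apply/TD|]; apply/step => a' i' j' E.
  - by have := TXYZ a'.+1 i' j'; rewrite exprS -!mulrA; apply; lia.
  - have -> : Y * (X ^+ a' * Y ^+ i' * Z ^+ j') = X ^+ a' * Y ^+ i'.+1 * Z ^+ j'.
      by rewrite exprS; ring.
    by apply: TXYZ; lia.
  - have -> : Z * (X ^+ a' * Y ^+ i' * Z ^+ j') = X ^+ a' * Y ^+ i' * Z ^+ j'.+1.
      by rewrite exprS; ring.
    by apply: TXYZ; lia.
rewrite [f]mpolyE big_seq; apply: (big_ind T) => // m mf.
by apply/TZ/Tmon/hf.
Qed.


(** * Coefficients of the elements of a colon ideal *)

Section Slices.
Variables (R : numFieldType) (n : nat) (i0 i1 : 'I_n).
Hypothesis i01 : i0 != i1.
Variable m0 : 'X_{1..n}.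
Hypotheses (m0i0 : m0 i0 = 0%N) (m0i1 : m0 i1 = 0%N).
Implicit Types (f g : {mpoly R[n]}).

(** The monomials that are [m0] times a monomial of degree [d] in the variables
    [i0] and [i1]. *)
Definition slice_mnm d j : 'X_{1..n} := (m0 + U_(i0) *+ (d - j) + U_(i1) *+ j)%MM.

(** Dehomogenization at ['X_i0 = 1] of the part of [f] made of the monomials
    [slice_mnm d j]. Since it selects a single degree, it applies to polynomials
    that are not homogeneous. *)
Definition slice d f : {poly R} := \poly_(j < d.+1) f@_(slice_mnm d j).

Lemma mcoeffMXU f i (m : 'X_{1..n}) :
  (f * 'X_i)@_m = if (0 < m i)%N then f@_(m - U_(i)) else 0.
Proof.
case: ltnP => mi.
  have Um : (U_(i) <= m)%MM.
    by apply/mnm_lepP => j; rewrite mnm1E; case: eqP => // <-.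
  by rewrite -{1}(submK Um) addmC mcoeffMX.
rewrite mcoeffM big1 // => -[k1 k2] /eqP /= E.
rewrite mcoeffX; case: eqP => [k2E|]; rewrite ?mulr0 //.
have := congr1 (fun t : 'X_{1..n} => t i) E; move: mi.
by rewrite mnmDE -k2E mnm1E eqxx addn1 => + mS; rewrite mS.
Qed.

Lemma slice_mulX0 d f : slice d.+1 (f * 'X_i0) = slice d f.
Proof.
apply/polyP => j; rewrite !coef_poly mcoeffMXU.
rewrite /slice_mnm !mnmDE !mulmnE !mnm1E eqxx m0i0 eq_sym (negbTE i01) mul0n add0n addn0 mul1n.
have [jd|jd] := ltnP j d.+1; last by case: ifP => // _; rewrite ifF //; lia.
rewrite ifT ?ifT; [|lia|lia]; congr mcoeff.
by apply/mnmP => t; rewrite !(mnmBE, mnmDE, mulmnE, mnm1E); case: eqP => _; lia.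
Qed.

Lemma slice_mulX1 d f : slice d.+1 (f * 'X_i1) = slice d f * 'X.
Proof.
apply/polyP => j; rewrite coefMX !coef_poly mcoeffMXU.
rewrite /slice_mnm !mnmDE !mulmnE !mnm1E eqxx m0i1 (negbTE i01) mul0n !add0n mul1n.
case: j => [|j] /=; first by [].
rewrite ltnS; case: ifP => // jd; congr mcoeff.
by apply/mnmP => t; rewrite !(mnmBE, mnmDE, mulmnE, mnm1E); case: eqP => _; lia.
Qed.

Lemma slice_linear d : linear (slice d).
Proof.
move=> a f g; apply/polyP => j; rewrite coefD coefZ !coef_poly.
by case: ifP => _; rewrite ?mcoeffD ?mcoeffZ // mulr0 addr0.
Qed.

Lemma slice_mul_linear d f a :
  slice d.+1 (f * ('X_i1 - a *: 'X_i0)) = slice d f * ('X - a%:P).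
Proof.
rewrite mulrBr -scalerAr addrC -scaleNr slice_linear slice_mulX0 slice_mulX1.
by rewrite scaleNr addrC mulrBr [_ * a%:P]mulrC mul_polyC.
Qed.

Lemma slice_mul_power d s f a :
  slice (d + s) (f * ('X_i1 - a *: 'X_i0) ^+ s) = slice d f * ('X - a%:P) ^+ s.
Proof.
elim: s => [|s IH]; first by rewrite addn0 !expr0 !mulr1.
by rewrite addnS !exprSr !mulrA slice_mul_linear IH.
Qed.

Lemma slice_mulX0_power d s f : slice (d + s) (f * 'X_i0 ^+ s) = slice d f.
Proof.
elim: s => [|s IH]; first by rewrite addn0 expr0 mulr1.
by rewrite addnS exprSr mulrA slice_mulX0 IH.
Qed.

Lemma slice_sum d (I : finType) (S : pred I) (F : I -> {mpoly R[n]}) :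
  slice d (\sum_(i | S i) F i) = \sum_(i | S i) slice d (F i).
Proof.
apply: (big_morph (slice d)) => [f g|].
  by have := slice_linear d 1 f g; rewrite !scale1r.
by apply/polyP => j; rewrite coef_poly mcoeff0 coef0 if_same.
Qed.

End Slices.

(** The polynomials in the pencil of [i0] and [i1] act on slices as univariate
    polynomials, and the coefficient of [m] is the top one of a slice, to which
    [pencil_powers_indep] applies. *)
Lemma colon_pencil_mcoeff (R : numFieldType) n (i0 i1 : 'I_n) (I : finType)
    (S : pred I) (c : I -> R) (r : nat) (m : 'X_{1..n}) (f : {mpoly R[n]}) :
  i0 != i1 -> m i0 = 0%N -> (num_values S c * (m i1).+1 <= r.+1)%N ->
  powers_ideal S (fun j => 'X_i1 - c j *: 'X_i0) r (f * 'X_i0 ^+ r.+1) ->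
  f@_m = 0.
Proof.
move=> i01 mi0 ke [B E]; set e := m i1 in ke.
pose m0 := (m - U_(i1) *+ e)%MM.
have m0i0 : m0 i0 = 0%N.
  by rewrite mnmBE mulmnE mnm1E eq_sym (negbTE i01) mul0n subn0.
have m0i1 : m0 i1 = 0%N by rewrite mnmBE mulmnE mnm1E eqxx mul1n subnn.
pose sl := @slice R n i0 i1 m0.
have slE : sl e f = \sum_(j | S j) sl e (B j) * ('X - (c j)%:P) ^+ r.+1.
  rewrite /sl -(slice_mulX0_power i01 m0i0 m0i1 e r.+1 f) E slice_sum.
  by apply: eq_bigr => j _; rewrite slice_mul_power.
have := pencil_powers_indep ke (fun j => size_poly _ _) (size_poly _ _) slE.
rewrite coef_poly ltnSn => <-; congr mcoeff; apply/mnmP => t.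
rewrite !(mnmDE, mnmBE, mulmnE, mnm1E) subnn muln0 addn0.
by case: eqP => [<-|_]; rewrite ?mul1n ?mul0n ?subn0 ?addn0 // subnK.
Qed.

(** After the change of variables [t], both summands have coefficient 0 at the
    monomial that [Y ^+ a * Z ^+ b] becomes, by [colon_pencil_mcoeff]. *)
Lemma separated_monomial_notin_colon_sum (R : numFieldType) (m n : nat) (I : finType)
    (S1 S2 : pred I) (c1 c2 : I -> R) (r a b : nat) (X Y Z : {mpoly R[m]})
    (t : m.-tuple {mpoly R[n]}) (s : R) (i0 i1 i2 : 'I_n) :
  i0 != i1 -> i0 != i2 -> i1 != i2 -> s != 0 ->
  X \mPo t = s *: 'X_i0 -> Y \mPo t = s *: 'X_i1 -> Z \mPo t = s *: 'X_i2 ->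
  (num_values S1 c1 * a.+1 <= r.+1)%N -> (num_values S2 c2 * b.+1 <= r.+1)%N ->
  ~ colon_sum (powers_ideal S1 (fun j => Y - c1 j *: X) r)
              (powers_ideal S2 (fun j => Z - c2 j *: X) r)
              (X ^+ r.+1) (Y ^+ a * Z ^+ b).
Proof.
move=> i01 i02 i12 s0 tX tY tZ k1a k2b [g1 [g2 [gE J1 J2]]].
pose u : 'X_{1..n} := (U_(i1) *+ a + U_(i2) *+ b)%MM.
have u0 : u i0 = 0%N.
  by rewrite mnmDE !mulmnE !mnm1E ![_ == i0]eq_sym (negbTE i01) (negbTE i02) !mul0n.
have u1 : u i1 = a.
  by rewrite mnmDE !mulmnE !mnm1E eqxx [i2 == _]eq_sym (negbTE i12) mul1n mul0n addn0.
have u2 : u i2 = b.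
  by rewrite mnmDE !mulmnE !mnm1E eqxx (negbTE i12) mul1n mul0n.
have push S (c : I -> R) W i g : W \mPo t = s *: 'X_i ->
    powers_ideal S (fun j => W - c j *: X) r (g * X ^+ r.+1) ->
    powers_ideal S (fun j => 'X_i - c j *: 'X_i0) r ((g \mPo t) * 'X_i0 ^+ r.+1).
  move=> tW [B E].
  have : powers_ideal S (fun j => 'X_i - c j *: 'X_i0) r
      (s ^+ r.+1 *: ((g \mPo t) * 'X_i0 ^+ r.+1)).
    apply/(powers_ideal_scale (b := fun=> s) (L := fun j => s *: ('X_i - c j *: 'X_i0))) => //.
    exists (fun j => B j \mPo t).
    have := congr1 (comp_mpoly t) E.
    rewrite rmorphM rmorphXn /= tX exprZn -scalerAr => ->.
    rewrite linear_sum /=; apply: eq_bigr => j _.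
    rewrite rmorphM rmorphXn /= comp_mpolyB comp_mpolyZ tX tW; congr (_ * _ ^+ _).
    by rewrite scalerBr !scalerA mulrC.
  move/(powers_idealZ (s ^- r.+1)).
  by rewrite scalerA mulVf ?scale1r // expf_neq0.
have z1 : (g1 \mPo t)@_u = 0.
  by apply: (colon_pencil_mcoeff i01 u0 _ (push _ _ _ _ _ tY J1)); rewrite u1.
have z2 : (g2 \mPo t)@_u = 0.
  by apply: (colon_pencil_mcoeff i02 u0 _ (push _ _ _ _ _ tZ J2)); rewrite u2.
have /eqP : (Y ^+ a * Z ^+ b \mPo t)@_u = 0 by rewrite gE raddfD /= mcoeffD z1 z2 addr0.
rewrite rmorphM !rmorphXn /= tY tZ !exprZn -scalerAl -scalerAr !mcoeffZ.
rewrite !mpolyXn -mpolyXD mcoeffX eqxx mulr1.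
by apply/negP; rewrite mulf_neq0 ?expf_neq0.
Qed.


(** * The module of the ideal complex with one totally interior edge *)

Lemma pihomog_mul_homog (R : realType) n d k (f g : {mpoly R[n]}) :
  g \is k.-homog ->
  pihomog mdeg (d + k) (f * g) = pihomog mdeg d f * g.
Proof.
move=> hg; pose K := maxn (mmeasure mdeg f) d.+1.
rewrite {1}(@pihomog_partitionE _ _ mdeg K f) ?leq_maxl //.
rewrite mulr_suml linear_sum /=.
have dK : (d < K)%N by rewrite leq_maxr.
rewrite (bigD1 (Ordinal dK)) //= big1 ?addr0.
  by rewrite pihomog_dE // dhomogM ?pihomogP.
move=> i /eqP/val_eqP /= id.
apply: (@pihomog_ne0 _ _ _ (i + k)%N); first by rewrite eqn_add2r.
by rewrite dhomogM ?pihomogP.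
Qed.

Lemma pihomog_mul_homog_lt (R : realType) n d k (f g : {mpoly R[n]}) :
  (d < k)%N -> g \is k.-homog -> pihomog mdeg d (f * g) = 0.
Proof.
move=> dk hg.
rewrite {1}(@pihomog_partitionE _ _ mdeg (mmeasure mdeg f) f) //.
rewrite mulr_suml linear_sum /= big1 // => i _.
apply: (@pihomog_ne0 _ _ _ (i + k)%N); first by lia.
by rewrite dhomogM ?pihomogP.
Qed.

(** The cardinality tests of the complex compare with elements of the semiring
    [nat]; these equations restate them with numerals. *)
Section Cardinals.
Variables (n : nat) (D : {set {set 'I_n}}).
Implicit Types e T : {set 'I_n}.

Lemma edgeE e : edge D e = (e \in D) && (#|e| == 2%N).
Proof. by []. Qed.

Lemma triangleE T : triangle D T = (T \in D) && (#|T| == 3%N).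
Proof. by []. Qed.

Lemma boundary_edgeE e :
  boundary_edge D e = edge D e && (#|[set T | triangle D T && (e \subset T)]| == 1%N).
Proof. by []. Qed.

Lemma partially_interiorE e :
  partially_interior D e = edge D e && (#|[set v in e | interior_vertex D v]| == 1%N).
Proof. by []. Qed.

End Cardinals.

Section Complex.
Variables (R : realType) (r n : nat) (D : {set {set 'I_n}}).
Variables (l : {set 'I_n} -> {mpoly R[3]}) (v1 v2 : 'I_n).
Hypothesis hone : forall e : {set 'I_n}, totally_interior D e <-> e = [set v1; v2].
Hypothesis hl : forall e, edge D e -> l e \is 1.-homog.

Implicit Types (u v w : 'I_n) (e : {set 'I_n}).

Let eps : {set 'I_n} := [set v1; v2].

Lemma totally_interior_eps : totally_interior D eps.
Proof. exact/hone. Qed.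

Lemma edge_eps : edge D eps.
Proof. by case/andP: totally_interior_eps. Qed.

Lemma eps_neq : v1 != v2.
Proof. by have := edge_eps; rewrite edgeE cards2 andbC; case: (v1 != v2). Qed.

Lemma interior_v1 : interior_vertex D v1.
Proof. by have /andP[_ /forall_inP] := totally_interior_eps; apply; rewrite set21. Qed.

Lemma interior_v2 : interior_vertex D v2.
Proof. by have /andP[_ /forall_inP] := totally_interior_eps; apply; rewrite set22. Qed.

Lemma interior_edge_at v e : interior_vertex D v -> v \in e ->
  interior_edge D e = edge D e.
Proof.
move=> vi ve; rewrite /interior_edge; case he: (edge D e) => //=.
by apply: contra vi => eb; apply/existsP; exists e; rewrite eb.
Qed.

Lemma edge_at_interior v e : interior_vertex D v -> edge D e -> v \in e ->
  (e == eps) || partially_interior D e.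
Proof.
move=> vi he ve; case/boolP: [forall u in e, interior_vertex D u] => [eint|].
  by apply/orP; left; apply/eqP/hone; rewrite /totally_interior he.
rewrite negb_forall => /existsP[u]; rewrite negb_imply => /andP[ue ui].
apply/orP; right; rewrite partially_interiorE he /=.
have uv : u != v by apply: contraNneq ui => ->.
have := he; rewrite edgeE => /andP[_ /cards2P[a [b [ab eE]]]].
apply/cards1P; exists v; apply/setP => w; rewrite !inE.
apply/andP/eqP => [[we wi]|->//].
have {}ue : (u == a) || (u == b) by rewrite eE !inE in ue.
have {}we : (w == a) || (w == b) by rewrite eE !inE in we.
have {}ve : (v == a) || (v == b) by rewrite eE !inE in ve.
have wu : w != u by apply: contraNneq ui => <-.
apply/eqP; move: ue we ve uv wu.
by do 3![case/orP=> /eqP ->]; rewrite ?eqxx //.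
Qed.

Lemma partially_interior_uniq u v e : partially_interior D e ->
  u \in e -> v \in e -> interior_vertex D u -> interior_vertex D v -> u = v.
Proof.
rewrite partially_interiorE => /andP[_ /cards1P[a eE]] ue ve ui vi.
have : u \in [set v in e | interior_vertex D v] by rewrite inE ue.
have : v \in [set v in e | interior_vertex D v] by rewrite inE ve.
by rewrite eE !inE => /eqP -> /eqP ->.
Qed.

Lemma partially_interior_eps : ~~ partially_interior D eps.
Proof.
apply/negP => /partially_interior_uniq /(_ (set21 _ _) (set22 _ _)).
by move=> /(_ interior_v1 interior_v2); apply/eqP/eps_neq.
Qed.

Definition partial_at v : pred {set 'I_n} :=
  fun e => partially_interior D e && (v \in e).

Definition partial_ideal v : {mpoly R[3]} -> Prop :=
  powers_ideal (partial_at v) l r.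

Lemma sum_edges_at v (F : {set 'I_n} -> {mpoly R[3]}) : v \in eps ->
  \sum_(e : {set 'I_n} | edge D e && (v \in e)) F e
    = F eps + \sum_(e | partial_at v e) F e.
Proof.
move=> ve; have vi : interior_vertex D v.
  by have /andP[_ /forall_inP] := totally_interior_eps; apply.
rewrite (bigD1 eps) ?edge_eps //=; congr (_ + _); apply: eq_bigl => e.
rewrite /partial_at; apply/idP/idP.
  move=> /andP[/andP[he ee] ne]; rewrite ee andbT.
  by have := edge_at_interior vi he ee; rewrite (negbTE ne).
move=> /andP[pe ee]; rewrite ee andbT; apply/andP; split; first by case/andP: pe.
by apply: contraTneq pe => ->; exact: partially_interior_eps.
Qed.

Definition sign_at v (e : {set 'I_n}) : {mpoly R[3]} :=
  (-1) ^+ [exists w in e, (v < w)%N].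

Lemma sign_at_sqr v e : sign_at v e * sign_at v e = 1.
Proof. by rewrite /sign_at -expr2 sqrr_sign. Qed.

Lemma sign_at_eps : sign_at v2 eps = - sign_at v1 eps.
Proof.
rewrite /sign_at.
have -> : [exists w in eps, (v1 < w)%N] = (v1 < v2)%N.
  apply/existsP/idP => [[w]|h]; last by exists v2; rewrite set22.
  by rewrite !inE => /andP[/orP[/eqP->|/eqP->]//]; rewrite ltnn.
have -> : [exists w in eps, (v2 < w)%N] = (v2 < v1)%N.
  apply/existsP/idP => [[w]|h]; last by exists v1; rewrite set21.
  by rewrite !inE => /andP[/orP[/eqP->|/eqP->]//]; rewrite ltnn.
by have := eps_neq; rewrite -val_eqE; case: ltngtP => //= _ _; rewrite ?expr1 ?expr0 ?opprK.
Qed.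

(** The class of [g] vanishes in the quotient of the ring by the sum of the two
    colon ideals. Up to a shift by [r.+1], this quotient is the module [H_0]: the
    edges other than [eps] make every summand vanish except those of [v1] and
    [v2], whose quotients are generated by the power of [l eps], and [eps]
    identifies the two generators up to sign. *)
Definition glue_class (g : {mpoly R[3]}) : Prop :=
  colon_sum (partial_ideal v1) (partial_ideal v2) (l eps ^+ r.+1) g.

Lemma rel_boundary_interior (G : {ffun {set 'I_n} -> {mpoly R[3]}}) v :
  interior_vertex D v ->
  rel_boundary D G v = \sum_(e : {set 'I_n} | edge D e && (v \in e)) sign_at v e * G e.
Proof.
move=> vi; rewrite ffunE vi; apply: eq_bigl => e.
by case ve: (v \in e); rewrite ?andbT ?andbF // (interior_edge_at vi ve).
Qed.

(** The chain that is [g * l eps ^+ r.+1] at [v1] and 0 elsewhere represents the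
    class of [g]: if it is the boundary of [G], the value of [G] at [eps] gives
    the two summands of [g]. *)
Lemma H0_neq0_of_not_glued (e : nat) g : g \is e.-homog -> ~ glue_class g ->
  H0_neq0 r D l (e + r.+1).
Proof.
move=> hg ng; pose f := [ffun v => if v == v1 then g * l eps ^+ r.+1 else 0].
have hle : l eps ^+ r.+1 \is (r.+1).-homog.
  by rewrite -[X in X.-homog]mul1n dhomogMn // hl // edge_eps.
exists f; split.
- move=> v; case: ifPn => vi; rewrite ffunE; last first.
    by case: eqP => // vE; move: vi; rewrite vE interior_v1.
  case: eqP => [->|_].
    exists (fun e' => if e' == eps then g * l eps ^+ r.+1 else 0).
      move=> e' _ _; case: eqP => [->|_]; first by exists g.
      by exists 0; rewrite mul0r.
    rewrite (bigD1 eps) /= ?edge_eps ?set21 // eqxx big1 ?addr0 //.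
    by move=> e' /andP[_ /negbTE ->].
  exists (fun=> 0); last by rewrite big1.
  by move=> e' _ _; exists 0; rewrite mul0r.
- by move=> v; rewrite ffunE; case: eqP => _; rewrite ?dhomogM ?rpred0.
move=> [G GJ Gf]; apply: ng.
have GE e' : exists q, interior_edge D e' -> G e' = q * l e' ^+ r.+1.
  by have := GJ e'; case: ifP => [_ [q ->]|_ _]; [exists q|exists 0].
have [q qE] := boolp.choice GE.
have ie v e' : interior_vertex D v -> edge D e' -> v \in e' -> interior_edge D e'.
  by move=> vi he ve; rewrite (interior_edge_at vi).
have sumE v : v \in eps -> interior_vertex D v ->
    f v - sign_at v eps * q eps * l eps ^+ r.+1
      = \sum_(e' | partial_at v e') sign_at v e' * q e' * l e' ^+ r.+1.
  move=> ve vi; rewrite -Gf rel_boundary_interior // sum_edges_at //.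
  rewrite qE ?(ie v) ?edge_eps // mulrA addrC addKr; apply: eq_bigr => e' /andP[pe ve'].
  by rewrite qE ?mulrA // (ie v) //; case/andP: pe.
exists (g - sign_at v1 eps * q eps), (sign_at v1 eps * q eps); split.
- by rewrite subrK.
- exists (fun e' => sign_at v1 e' * q e').
  by rewrite -sumE ?set21 ?interior_v1 // ffunE eqxx mulrBl.
exists (fun e' => sign_at v2 e' * q e').
rewrite -sumE ?set22 ?interior_v2 // ffunE eq_sym (negbTE eps_neq).
by rewrite sign_at_eps !mulNr opprK add0r.
Qed.

(** The contribution of an edge to one of its interior endpoints determines the
    value of a preimage on this edge; only [eps] has two such endpoints, whence
    the compatibility condition. *)
Lemma in_boundary_of_compatible (f : {ffun 'I_n -> {mpoly R[3]}})
    (A : 'I_n -> {set 'I_n} -> {mpoly R[3]}) :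
  (forall v, ~~ interior_vertex D v -> f v = 0) ->
  (forall v, interior_vertex D v ->
     f v = \sum_(e : {set 'I_n} | edge D e && (v \in e)) A v e * l e ^+ r.+1) ->
  A v2 eps = - A v1 eps ->
  (@rel_boundary R n D @` direct_sum (interior_edge D) (J_edge r l))%classic f.
Proof.
move=> f0 fA Aeps.
pose G := [ffun e : {set 'I_n} => if interior_edge D e then
   if [pick u in e | interior_vertex D u] is Some u
   then sign_at u e * A u e * l e ^+ r.+1 else 0 else 0].
exists G.
  move=> e; rewrite ffunE; case ie: (interior_edge D e) => //; case: pickP => [u _|_].
    by exists (sign_at u e * A u e).
  by exists 0; rewrite mul0r.
apply/ffunP => v; have [vi|vi] := boolP (interior_vertex D v); last first.
  by rewrite f0 // ffunE (negbTE vi).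
rewrite rel_boundary_interior // fA //; apply: eq_bigr => e /andP[he ve].
rewrite ffunE (interior_edge_at vi ve) he.
case: pickP => [u /andP[ue ui]|/(_ v)]; last by rewrite ve vi.
rewrite !mulrA; congr (_ * _).
have [->|uv] := eqVneq u v; first by rewrite sign_at_sqr mul1r.
have /orP[/eqP eE|pe] := edge_at_interior vi he ve; last first.
  by move/eqP: uv; have := partially_interior_uniq pe ue ve ui vi.
move: ue ve uv; rewrite eE !inE.
case/orP=> /eqP ->; case/orP=> /eqP ->; rewrite ?eqxx // => _.
  by rewrite sign_at_eps mulNr sign_at_sqr mulNr mul1r Aeps.
by rewrite sign_at_eps mulrN sign_at_sqr mulNr mul1r Aeps opprK.
Qed.

(** If [A'] gives homogeneous coefficients of [f], the obstruction to [f] being a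
    boundary is the class of [A' v1 eps + A' v2 eps]. *)
Lemma not_glued_of_H0_neq0 d : H0_neq0 r D l d ->
  exists (e : nat) g, [/\ d = (e + r.+1)%N, g \is e.-homog & ~ glue_class g].
Proof.
move=> [f [fJ fh fB]].
have hle e' : edge D e' -> l e' ^+ r.+1 \is (r.+1).-homog.
  by move=> he; rewrite -[X in X.-homog]mul1n dhomogMn // hl.
have fAE v : exists A : {set 'I_n} -> {mpoly R[3]}, interior_vertex D v ->
    f v = \sum_(e : {set 'I_n} | edge D e && (v \in e)) A e * l e ^+ r.+1.
  have := fJ v; case: ifP => [_ [g gJ ->]|_ _]; last by exists (fun=> 0).
  have gE e : exists q, edge D e && (v \in e) -> g e = q * l e ^+ r.+1.
    have [/andP[he ve]|_] := boolP (edge D e && (v \in e)); last by exists 0.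
    by have [q ->] := gJ e he ve; exists q.
  have [q qE] := boolp.choice gE; exists q => _.
  by apply: eq_bigr => e /qE.
have [A AE] := boolp.choice fAE.
have f0 v : ~~ interior_vertex D v -> f v = 0.
  by move=> /negbTE vi; have := fJ v; rewrite vi.
have fpi v : interior_vertex D v -> f v =
    \sum_(e : {set 'I_n} | edge D e && (v \in e)) pihomog mdeg d (A v e * l e ^+ r.+1).
  by move=> vi; rewrite -[LHS](pihomog_dE (fh v)) AE // linear_sum.
have [dr|rd] := ltnP d r.+1.
  exfalso; apply: fB; apply: (@in_boundary_of_compatible f (fun _ _ => 0)) => //.
    move=> v vi; rewrite fpi //; apply: eq_bigr => e /andP[he _].
    by rewrite (pihomog_mul_homog_lt _ dr) ?hle // mul0r.
  by rewrite oppr0.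
pose A' v e := pihomog mdeg (d - r.+1) (A v e).
have fA' v : interior_vertex D v ->
    f v = \sum_(e : {set 'I_n} | edge D e && (v \in e)) A' v e * l e ^+ r.+1.
  move=> vi; rewrite fpi //; apply: eq_bigr => e /andP[he _].
  by rewrite -{1}(subnK rd) pihomog_mul_homog ?hle.
exists (d - r.+1)%N, (A' v1 eps + A' v2 eps); split; first by rewrite subnK.
  by rewrite rpredD ?pihomogP.
move=> [g1 [g2 [gE [B1 B1E] [B2 B2E]]]]; apply: fB.
(* The coefficients at eps are corrected by g1 and g2, and those of the partially
   interior edges compensate for it. *)
pose A'' v e :=
  if e == eps then A' v e - (if v == v1 then g1 else g2)
  else A' v e + (if v == v1 then B1 e else if v == v2 then B2 e else 0).
apply: (@in_boundary_of_compatible f A'') => //; last first.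
  rewrite /A'' !eqxx eq_sym (negbTE eps_neq).
  move: gE; rewrite addrC => /(canRL (addrK _)) ->.
  by rewrite opprB; ring.
have neps v e : partial_at v e -> (e == eps) = false.
  by case/andP=> pe _; apply/negbTE; apply: contraTneq pe => ->; exact: partially_interior_eps.
move=> v vi; rewrite fA' //.
have [ve|ve] := boolP (v \in eps); last first.
  apply: eq_bigr => e /andP[_ vine]; rewrite /A''.
  have -> : (e == eps) = false by apply/negbTE; apply: contraNneq ve => <-.
  by move: ve; rewrite !inE negb_or => /andP[/negbTE -> /negbTE ->]; rewrite addr0.
rewrite !sum_edges_at //.
have -> : A'' v eps = A' v eps - (if v == v1 then g1 else g2) by rewrite /A'' eqxx.
have -> : \sum_(e | partial_at v e) A'' v e * l e ^+ r.+1
   = \sum_(e | partial_at v e) A' v e * l e ^+ r.+1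
     + (if v == v1 then g1 else g2) * l eps ^+ r.+1.
  have -> : (if v == v1 then g1 else g2) * l eps ^+ r.+1
      = \sum_(e | partial_at v e) (if v == v1 then B1 e else if v == v2 then B2 e else 0)
          * l e ^+ r.+1.
    move: ve; rewrite !inE => /orP[/eqP->|/eqP->]; first by rewrite eqxx.
    by rewrite eq_sym (negbTE eps_neq) eqxx.
  rewrite -big_split; apply: eq_bigr => e pe.
  by rewrite /A'' (neps v) // mulrDl.
by rewrite mulrBl; ring.
Qed.

End Complex.

(** * Linear forms on the lifted plane *)

Lemma size_undup_map (I : eqType) (T U : eqType) (F : I -> T) (G : I -> U) (s : seq I) :
  {in s &, forall x y, (F x == F y) = (G x == G y)} ->
  size (undup (map F s)) = size (undup (map G s)).
Proof.
elim: s => //= x s IH FG.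
have FGs : (F x \in map F s) = (G x \in map G s).
  have FGx y : y \in s -> (F x == F y) = (G x == G y).
    by move=> ys; rewrite FG ?inE ?eqxx ?ys ?orbT.
  by apply/mapP/mapP => -[y ys /eqP E]; exists y => //; apply/eqP;
    rewrite ?FGx // -FGx.
have {}IH : size (undup (map F s)) = size (undup (map G s)).
  by apply: IH => a b sa sb; apply: FG; rewrite inE ?sa ?sb orbT.
by rewrite FGs; case: ifP => _ //=; rewrite IH.
Qed.

Section Plane.
Variable R : realType.
Implicit Types (u v w q d h : 'rV[R]_2) (f : {mpoly R[3]}).

Definition cross u v : R := u 0 0 * v 0 1 - u 0 1 * v 0 0.
Definition dot u v : R := u 0 0 * v 0 0 + u 0 1 * v 0 1.

Lemma row2_eq0 u : u 0 0 = 0 -> u 0 1 = 0 -> u = 0.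
Proof.
move=> u0 u1; apply/rowP => -[[|[|//]] i2]; rewrite !mxE.
  by rewrite -[RHS]u0; congr (u _ _); apply: val_inj.
by rewrite -[RHS]u1; congr (u _ _); apply: val_inj.
Qed.

Lemma dotvv_eq0 u : (dot u u == 0) = (u == 0).
Proof.
apply/eqP/eqP => [|->]; last by rewrite /dot !mxE; ring.
rewrite /dot => /eqP; rewrite paddr_eq0 -?expr2 ?sqr_ge0 // !sqrf_eq0.
by case/andP=> /eqP u0 /eqP u1; apply: row2_eq0.
Qed.

Lemma slope_eq q u v : u != q -> v != q ->
  (slope q u == slope q v) = (cross (u - q) (v - q) == 0).
Proof.
rewrite -subr_eq0 -[v == q]subr_eq0.
have ne w : w != 0 -> w 0 0 = 0 -> w 0 1 != 0.
  by move=> w0 w00; apply: contra w0 => /eqP w01; apply/eqP/row2_eq0.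
move=> /ne uq /ne vq; rewrite /slope /cross.
move: uq vq; rewrite !mxE.
have sw (a b : R) : (a == b) = (b - a == 0) by rewrite subr_eq0 eq_sym.
rewrite !(sw (q 0 0)).
set u0 := u 0 0 - _; set v0 := v 0 0 - _; set u1 := u 0 1 - _; set v1 := v 0 1 - _.
have [->|u0n] := eqVneq u0 0; have [->|v0n] := eqVneq v0 0 => uq vq.
- by rewrite mul0r mulr0 subrr !eqxx.
- rewrite mul0r sub0r oppr_eq0 mulf_eq0 (negbTE v0n) orbF.
  by rewrite (negbTE (uq erefl)).
- rewrite mulr0 subr0 mulf_eq0 (negbTE u0n) /=.
  by rewrite (negbTE (vq erefl)).
apply/eqP/eqP => [[]|].
  by move/eqP; rewrite eqr_div // => /eqP; rewrite mulrC => ->; rewrite mulrC subrr.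
move/eqP; rewrite subr_eq0 => /eqP E; congr Some; apply/eqP.
by rewrite eqr_div // -E mulrC.
Qed.

Lemma homog1E n (g : {mpoly R[n]}) : g \is 1.-homog ->
  g = \sum_(i < n) g@_U_(i) *: 'X_i.
Proof.
move=> hf; apply/mpolyP => m; rewrite linear_sum /=.
have [/eqP/mdeg1P[i /eqP ->]|m1] := eqVneq (mdeg m) 1%N.
  rewrite (bigD1 i) //= mcoeffZ mcoeffX eqxx mulr1 big1 ?addr0 // => j ji.
  by rewrite mcoeffZ mcoeffXU (negbTE ji) mulr0.
rewrite (dhomog_nemf_coeff hf m1) big1 // => i _.
rewrite mcoeffZ mcoeffX; case: eqP => [mE|]; rewrite ?mulr0 //.
by move: m1; rewrite -mE mdeg1.
Qed.

Definition grad f : 'rV[R]_2 := \row_(j < 2) f@_U_(widen_ord (leqnSn 2) j).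

Definition lift_point q : 'rV[R]_3 := row_mx q (1%:M : 'rV[R]_1).

Definition var (i : 'I_3) : {mpoly R[3]} := 'X_i.
Definition offset0 q : {mpoly R[3]} := var 0 - q 0 0 *: var 2.
Definition offset1 q : {mpoly R[3]} := var 1 - q 0 1 *: var 2.

(** The equations of the lines through [q] that are perpendicular to [h], for
    [along], and parallel to [h], for [across]. *)
Definition along h q : {mpoly R[3]} := h 0 0 *: offset0 q + h 0 1 *: offset1 q.
Definition across h q : {mpoly R[3]} := h 0 0 *: offset1 q - h 0 1 *: offset0 q.

Lemma linear_form3 f : f \is 1.-homog ->
  f = grad f 0 0 *: var 0 + grad f 0 1 *: var 1 + f@_U_(2) *: var 2.
Proof.
move=> hf; rewrite {1}(homog1E hf) !big_ord_recr big_ord0 /= add0r !mxE /var.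
by congr (_ *: 'X_ _ + _ *: 'X_ _ + _ *: 'X_ _); try congr (f@_U_(_)); apply: val_inj.
Qed.

Lemma meval_linear_form3 f q : f \is 1.-homog ->
  f.@[lift_point q 0] = dot (grad f) q + f@_U_(2).
Proof.
move=> hf; rewrite {1}(linear_form3 hf) /var !mevalD !mevalZ !mevalXU /dot.
have -> : lift_point q 0 0 = q 0 0.
  by rewrite /lift_point -(row_mxEl q 1%:M); congr (row_mx _ _ _ _); apply: val_inj.
have -> : lift_point q 0 1 = q 0 1.
  by rewrite /lift_point -(row_mxEl q 1%:M); congr (row_mx _ _ _ _); apply: val_inj.
have -> : lift_point q 0 2 = 1.
  have -> : (2 : 'I_3) = rshift 2 (0 : 'I_1) by apply: val_inj.
  by rewrite /lift_point (row_mxEr q 1%:M) mxE eqxx.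
by rewrite mulr1.
Qed.

(** A linear form vanishing at the lift of [q] is determined by its gradient, and
    the gradients of [along h q] and [across h q] are [h] and [h] turned by a
    right angle. *)
Lemma linear_form_decomposition f q h : f \is 1.-homog ->
  f.@[lift_point q 0] = 0 ->
  dot h h *: f = dot (grad f) h *: along h q + cross h (grad f) *: across h q.
Proof.
move=> hf; rewrite meval_linear_form3 // addrC => /eqP; rewrite addr_eq0 => /eqP f2.
rewrite {1}(linear_form3 hf) f2 /along /across /offset0 /offset1 /dot /cross.
move: (grad f 0 0) (grad f 0 1) (h 0 0) (h 0 1) (q 0 0) (q 0 1) => a b c d x y.
rewrite -!mul_mpolyC !(mpolyCD, mpolyCN, mpolyCM, mpolyCB); ring.
Qed.


(** The coordinate of [f] in the pencil of [along h q] and [across h q]. If [f]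
    vanishes on a line with direction [d], it is the cotangent of an angle between
    [d] and [h], as [cotangentE] shows. *)
Definition cotangent h f : R := - cross h (grad f) / dot (grad f) h.

Lemma grad_orthogonal f q d : f \is 1.-homog ->
  f.@[lift_point q 0] = 0 -> f.@[lift_point (q + d) 0] = 0 -> dot (grad f) d = 0.
Proof.
move=> hf; rewrite !meval_linear_form3 // => fq fd.
rewrite -[RHS](subrr 0) -{1}fd -fq /dot !mxE; ring.
Qed.

Lemma grad_neq0 f q : f \is 1.-homog -> f != 0 -> f.@[lift_point q 0] = 0 ->
  grad f != 0.
Proof.
move=> hf f0; rewrite meval_linear_form3 // => fq; apply: contra f0 => /eqP g0.
move: fq; rewrite g0 /dot !mxE !mul0r !add0r => f2.
by rewrite (linear_form3 hf) g0 f2 !mxE !scale0r !addr0.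
Qed.

Lemma dot_grad_neq0 f q d h : f \is 1.-homog -> f != 0 ->
  f.@[lift_point q 0] = 0 -> f.@[lift_point (q + d) 0] = 0 -> cross d h != 0 ->
  dot (grad f) h != 0.
Proof.
move=> hf f0 fq fd dh; apply: contra (grad_neq0 hf f0 fq) => /eqP gh.
have gd := grad_orthogonal hf fq fd.
apply/eqP/row2_eq0; apply/(mulIf dh); rewrite mul0r.
  transitivity (dot (grad f) d * h 0 1 - dot (grad f) h * d 0 1).
    by rewrite /dot /cross; ring.
  by rewrite gd gh !mul0r subr0.
transitivity (dot (grad f) h * d 0 0 - dot (grad f) d * h 0 0).
  by rewrite /dot /cross; ring.
by rewrite gd gh !mul0r subr0.
Qed.

Lemma cotangentE f q d h : f \is 1.-homog -> f != 0 ->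
  f.@[lift_point q 0] = 0 -> f.@[lift_point (q + d) 0] = 0 -> cross d h != 0 ->
  cotangent h f = - dot d h / cross d h.
Proof.
move=> hf f0 fq fd dh.
have gh := dot_grad_neq0 hf f0 fq fd dh.
have gd := grad_orthogonal hf fq fd.
apply/eqP; rewrite eqr_div // -subr_eq0; apply/eqP.
transitivity (dot (grad f) d * dot h h); first by rewrite /dot /cross; ring.
by rewrite gd mul0r.
Qed.

Lemma pencil_form f q d h : f \is 1.-homog -> f != 0 ->
  f.@[lift_point q 0] = 0 -> f.@[lift_point (q + d) 0] = 0 -> cross d h != 0 ->
  f = (dot (grad f) h / dot h h) *: (along h q - cotangent h f *: across h q).
Proof.
move=> hf f0 fq fd dh.
have gh := dot_grad_neq0 hf f0 fq fd dh.
have hh : dot h h != 0.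
  rewrite dotvv_eq0; apply: contra dh => /eqP ->.
  by rewrite /cross !mxE !mulr0 subrr.
apply: (scalerI hh); rewrite (linear_form_decomposition h hf fq).
have gc : dot (grad f) h * cotangent h f = - cross h (grad f).
  by rewrite mulrC divfK.
rewrite scalerA [dot h h * _]mulrC divfK // [RHS]scalerBr; congr (_ + _).
by rewrite [X in - X]scalerA gc scaleNr opprK.
Qed.

Lemma axis_form f q h : f \is 1.-homog -> f != 0 ->
  f.@[lift_point q 0] = 0 -> f.@[lift_point (q + h) 0] = 0 -> h != 0 ->
  exists2 b, b != 0 & f = b *: across h q.
Proof.
move=> hf f0 fq fh h0.
have hh : dot h h != 0 by rewrite dotvv_eq0.
exists (cross h (grad f) / dot h h).
  apply: contra f0 => /eqP b0; apply/eqP; apply: (scalerI hh).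
  rewrite (linear_form_decomposition h hf fq) (grad_orthogonal hf fq fh).
  by move: b0 => /eqP; rewrite mulf_eq0 invr_eq0 (negbTE hh) orbF => /eqP ->;
    rewrite !scale0r addr0 scaler0.
apply: (scalerI hh); rewrite (linear_form_decomposition h hf fq).
rewrite (grad_orthogonal hf fq fh) scale0r add0r scalerA.
by rewrite [dot h h * _]mulrC divfK.
Qed.

Lemma across_shift h q : across h (q + h) = across h q.
Proof.
rewrite /across /offset0 /offset1 !mxE.
by rewrite -!mul_mpolyC !(mpolyCD, mpolyCN, mpolyCM, mpolyCB); ring.
Qed.

(** Two lines have the same cotangent exactly when they are parallel: after
    clearing denominators, their difference is [dot h h * cross d d']. *)
Lemma cotangent_eq d d' h : cross d h != 0 -> cross d' h != 0 ->
  (- dot d h / cross d h == - dot d' h / cross d' h) = (cross d d' == 0).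
Proof.
move=> dh d'h.
have hh : dot h h != 0.
  rewrite dotvv_eq0; apply: contra dh => /eqP ->.
  by rewrite /cross !mxE !mulr0 subrr.
rewrite eqr_div // -subr_eq0.
have -> : - dot d h * cross d' h - - dot d' h * cross d h = dot h h * cross d d'.
  by rewrite /dot /cross; ring.
by rewrite mulf_eq0 (negbTE hh).
Qed.

(** The forms [along h q] and [along h (q + h)] differ by [dot h h *: var 2]. *)
Lemma var_span h q (i : 'I_3) : h != 0 -> exists a b c : R,
  'X_i = a *: across h q + b *: along h q + c *: along h (q + h).
Proof.
move=> h0; have hh : dot h h != 0 by rewrite dotvv_eq0.
have step (x : {mpoly R[3]}) (a b c : R) :
    dot h h *: x = a *: across h q + b *: along h q + c *: along h (q + h) ->
    exists a b c : R, x = a *: across h q + b *: along h q + c *: along h (q + h).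
  move=> E; exists ((dot h h)^-1 * a), ((dot h h)^-1 * b), ((dot h h)^-1 * c).
  apply: (scalerI hh); rewrite E; move: (across h q) (along h q) (along h _) => X Y Z.
  by rewrite !scalerDr !scalerA !mulrA divff // !mul1r.
case: i => -[|[|[|//]]] i3.
- have -> : Ordinal i3 = 0 by apply: val_inj.
  apply: (step _ (- h 0 1) (h 0 0 + q 0 0) (- q 0 0)).
  rewrite /across /along /offset0 /offset1 /var /dot !mxE.
  by rewrite -!mul_mpolyC !(mpolyCD, mpolyCN, mpolyCM, mpolyCB); ring.
- have -> : Ordinal i3 = 1 by apply: val_inj.
  apply: (step _ (h 0 0) (h 0 1 + q 0 1) (- q 0 1)).
  rewrite /across /along /offset0 /offset1 /var /dot !mxE.
  by rewrite -!mul_mpolyC !(mpolyCD, mpolyCN, mpolyCM, mpolyCB); ring.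
have -> : Ordinal i3 = 2 by apply: val_inj.
apply: (step _ 0 1 (-1)).
rewrite /across /along /offset0 /offset1 /var /dot !mxE.
by rewrite -!mul_mpolyC !(mpolyCD, mpolyCN, mpolyCM, mpolyCB) mpolyC0 mpolyC1; ring.
Qed.

(** The substitution inverse, up to the factor [dot h h], to taking the three
    forms [across h q], [along h q] and [along h (q + h)] as variables. *)
Definition coordinates h q : 3.-tuple {mpoly R[3]} := [tuple
  h 0 0 *: var 1 - h 0 1 *: var 0 + q 0 0 *: (var 1 - var 2);
  h 0 1 *: var 1 + h 0 0 *: var 0 + q 0 1 *: (var 1 - var 2);
  var 1 - var 2].

Lemma comp_var0 h q : var 0 \mPo coordinates h q =
  h 0 0 *: var 1 - h 0 1 *: var 0 + q 0 0 *: (var 1 - var 2).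
Proof. by rewrite /var comp_mpolyXU. Qed.

Lemma comp_var1 h q : var 1 \mPo coordinates h q =
  h 0 1 *: var 1 + h 0 0 *: var 0 + q 0 1 *: (var 1 - var 2).
Proof. by rewrite /var comp_mpolyXU. Qed.

Lemma comp_var2 h q : var 2 \mPo coordinates h q = var 1 - var 2.
Proof. by rewrite /var comp_mpolyXU. Qed.

Definition comp_vars h q := (comp_var0 h q, comp_var1 h q, comp_var2 h q).

Lemma comp_across h q : across h q \mPo coordinates h q = dot h h *: var 0.
Proof.
rewrite /across /offset0 /offset1 !(comp_mpolyB, comp_mpolyD, comp_mpolyZ) !comp_vars.
by rewrite -!mul_mpolyC /dot !(mpolyCD, mpolyCN, mpolyCM, mpolyCB); ring.
Qed.

Lemma comp_along h q : along h q \mPo coordinates h q = dot h h *: var 1.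
Proof.
rewrite /along /offset0 /offset1 !(comp_mpolyB, comp_mpolyD, comp_mpolyZ) !comp_vars.
by rewrite -!mul_mpolyC /dot !(mpolyCD, mpolyCN, mpolyCM, mpolyCB); ring.
Qed.

Lemma comp_along_shift h q : along h (q + h) \mPo coordinates h q = dot h h *: var 2.
Proof.
rewrite /along /offset0 /offset1 !(comp_mpolyB, comp_mpolyD, comp_mpolyZ) !comp_vars !mxE.
by rewrite -!mul_mpolyC /dot !(mpolyCD, mpolyCN, mpolyCM, mpolyCB); ring.
Qed.

Lemma var_homog (i : 'I_3) : var i \is 1.-homog.
Proof. by rewrite /var dhomogX; apply/eqP/mdeg1. Qed.

Lemma along_homog h q : along h q \is 1.-homog.
Proof.
have offset_homog i a : var i - a *: var 2 \is 1.-homog.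
  by rewrite rpredB ?rpredZ ?var_homog.
by rewrite rpredD ?rpredZ ?offset_homog.
Qed.

End Plane.

(** * The star of an endpoint of the totally interior edge *)

Lemma set2_of_mem (T : finType) (e : {set T}) (v : T) :
  #|e| == 2%N -> v \in e -> exists2 u, u != v & e = [set v; u].
Proof.
move=> /cards2P[a [b [ab ->]]]; rewrite !inE => /orP[/eqP->|/eqP->].
  by exists b; rewrite // eq_sym.
by exists a; rewrite // finset.setUC.
Qed.

Lemma set3_of_mem (T : finType) (A : {set T}) (v a : T) :
  #|A| == 3%N -> v \in A -> a \in A -> a != v ->
  exists2 c, (c != v) && (c != a) & A = [set v; a; c].
Proof.
move=> cA vA aA av.
have : #|A :\ v :\ a| == 1%N.
  have aA' : a \in A :\ v by rewrite !inE av.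
  by move: cA; rewrite (cardsD1 v A) vA (cardsD1 a (A :\ v)) aA'.
move=> /cards1P[c cE]; exists c.
  by have : c \in [set c] by [rewrite set11]; rewrite -cE !inE => /and3P[-> -> _].
apply/setP => x; have xc : (x == c) = (x \in A :\ v :\ a) by rewrite cE inE.
rewrite !inE xc !inE.
have [->|xv] := eqVneq x v; first by rewrite vA.
by have [->|xa] := eqVneq x a; rewrite ?aA //= andbT.
Qed.

Section Star.
Variables (R : realType) (r n : nat) (D : {set {set 'I_n}}) (p : 'I_n -> 'rV[R]_2).
Variables (v1 v2 : 'I_n).
Hypothesis hD : embedded_complex D p.
Hypothesis hone : forall e : {set 'I_n}, totally_interior D e <-> e = [set v1; v2].
Implicit Types (u v w a c : 'I_n) (e : {set 'I_n}).

Lemma edge_points_neq v w : v != w -> [set v; w] \in D -> p w != p v.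
Proof.
move=> vw hvw; apply/negP => /eqP pvw.
have sum2 (V : zmodType) (F : 'I_n -> V) : \sum_(i in [set v; w]) F i = F v + F w.
  by rewrite big_setU1 ?inE // big_set1.
have := face_affinely_independent hD hvw (t := fun i => if i == v then 1 else -1).
rewrite !sum2 /= eqxx [w == v]eq_sym (negbTE vw) subrr pvw scale1r scaleN1r subrr.
by move=> /(_ erefl erefl v (set21 _ _)) /eqP; rewrite eqxx oner_eq0.
Qed.

(** A linear relation between the two edge vectors is an affine relation between
    the three vertices. *)
Lemma triangle_cross v a c : a != v -> c != v -> c != a -> [set v; a; c] \in D ->
  cross (p a - p v) (p c - p v) != 0.
Proof.
move=> av cv ca hT; pose d := p a - p v; pose d' := p c - p v.
have sum3 (V : zmodType) (F : 'I_n -> V) :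
    \sum_(i in [set v; a; c]) F i = F v + F a + F c.
  rewrite finset.setUC big_setU1 ?inE ?negb_or ?cv ?ca //.
  by rewrite big_setU1 ?inE 1?eq_sym // big_set1 addrC.
have indep (s t : R) : s * d 0 0 + t * d' 0 0 = 0 -> s * d 0 1 + t * d' 0 1 = 0 ->
    s = 0 /\ t = 0.
  move=> e0 e1.
  pose tt i := if i == v then - (s + t) else if i == a then s else t.
  have ttv : tt v = - (s + t) by rewrite /tt eqxx.
  have tta : tt a = s by rewrite /tt (negbTE av) eqxx.
  have ttc : tt c = t by rewrite /tt (negbTE cv) (negbTE ca).
  have := face_affinely_independent hD hT (t := tt).
  rewrite !sum3 ttv tta ttc => /(_ _ _) H.
  have {}H : forall i, i \in [set v; a; c] -> tt i = 0.
    apply: H; first by ring.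
    have -> : - (s + t) *: p v + s *: p a + t *: p c = s *: d + t *: d'.
      by apply/rowP => j; rewrite !mxE; ring.
    by apply: row2_eq0; rewrite !mxE; move: e0 e1; rewrite !mxE.
  by rewrite -{1}tta -ttc; split; apply: H; rewrite !inE eqxx ?orbT.
apply/negP => /eqP; rewrite -/d -/d' /cross => dd.
have [|| d'0 /eqP] := indep (d' 0 0) (- d 0 0).
- by ring.
- by transitivity (- (d 0 0 * d' 0 1 - d 0 1 * d' 0 0)); [ring|rewrite dd oppr0].
rewrite oppr_eq0 => /eqP d0.
have [|| d'1 /eqP] := indep (d' 0 1) (- d 0 1).
- by rewrite d0 d'0 !mulr0 addr0.
- by ring.
rewrite oppr_eq0 => /eqP d1.
have [||/eqP] := indep 1 0; rewrite ?d0 ?d1 ?mulr0 ?mul0r ?addr0 //.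
by rewrite oner_eq0.
Qed.

Lemma sub_face e A : A \in D -> e \subset A -> #|e| == 2%N -> edge D e.
Proof.
move=> hA eA ce; rewrite edgeE ce andbT; apply: (face_sub hD hA eA).
by rewrite -cards_eq0 (eqP ce).
Qed.

(** A triangle on the totally interior edge has a third vertex [a], and the edge
    from [v] to [a] is partially interior. As [v] is interior, this edge lies in
    another triangle, with third vertex [c]; the edge from [v] to [c] is partially
    interior too, and the slopes differ since [v], [a], [c] are not collinear. *)
Lemma two_partial_slopes v w : pure2 D -> [set v; w] = [set v1; v2] ->
  (1 < num_partial_slopes D p v)%N.
Proof.
move=> [_ hpure] vwE.
have tot : totally_interior D [set v; w] by apply/hone.
have hvw : edge D [set v; w] by case/andP: tot.
have vi : interior_vertex D v.
  by case/andP: tot => _ /forall_inP; apply; rewrite set21.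
have wv : w != v.
  by apply: contraTneq hvw => ->; rewrite edgeE cards2 eqxx andbF.
have [T + vwT] : exists2 T, triangle D T & [set v; w] \subset T.
  by apply: hpure; case/andP: hvw.
rewrite triangleE => /andP[TD cT].
have [vT wT] : v \in T /\ w \in T by move: vwT; rewrite finset.subUset !finset.sub1set => /andP.
have [a /andP[av aw] TE] := set3_of_mem cT vT wT wv.
have aT : a \in T by rewrite TE !inE eqxx orbT.
have hva : edge D [set v; a].
  by apply: (sub_face TD); rewrite ?finset.subUset ?finset.sub1set ?vT ?cards2 // [v == a]eq_sym av.
have : ~~ boundary_edge D [set v; a].
  by have := interior_edge_at vi (set21 v a); rewrite hva /interior_edge => /andP[].
rewrite boundary_edgeE hva /=; set St := finset _ => nT1.
have [T' T'h T'T] : exists2 T', triangle D T' && ([set v; a] \subset T') & T' != T.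
  have Tin : T \in St by rewrite inE triangleE TD cT finset.subUset !finset.sub1set vT aT.
  have : (0 < #|St :\ T|)%N by move: nT1; rewrite (cardsD1 T St) Tin; case: #|_|.
  by case/card_gt0P => T'; rewrite !inE => /andP[? ?]; exists T'.
move: T'h; rewrite triangleE finset.subUset !finset.sub1set => /andP[/andP[T'D cT'] /andP[vT' aT']].
have [c /andP[cv ca] T'E] := set3_of_mem cT' vT' aT' av.
have cT'' : c \in T' by rewrite T'E !inE eqxx orbT.
have cw : c != w by apply: contraNneq T'T => cwE; rewrite T'E TE cwE finset.setUAC.
have hvc : edge D [set v; c].
  by apply: (sub_face T'D); rewrite ?finset.subUset ?finset.sub1set ?vT' //
    cards2 [v == c]eq_sym cv.
have partial u : u != v -> u != w -> edge D [set v; u] ->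
    partially_interior D [set v; u].
  move=> uv uw hvu; have := edge_at_interior hone vi hvu (set21 _ _).
  rewrite -vwE; case: eqP => // /setP/(_ u).
  by rewrite !inE eqxx orbT (negbTE uv) (negbTE uw).
rewrite T'E in T'D.
have cr := triangle_cross av cv ca T'D.
have pa : p a != p v by apply: edge_points_neq; [rewrite eq_sym|case/andP: hva].
have pc : p c != p v by apply: edge_points_neq; [rewrite eq_sym|case/andP: hvc].
have := slope_eq pa pc; rewrite (negbTE cr) => /negbT sl.
rewrite /num_partial_slopes.
have -> : 2%N = size [:: slope (p v) (p a); slope (p v) (p c)] by [].
apply: uniq_leq_size; first by rewrite /= inE sl.
by move=> s; rewrite !inE mem_undup => /orP[]/eqP ->; apply: map_f;
  rewrite mem_filter mem_enum andbT partial.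
Qed.

Variables (l : {set 'I_n} -> {mpoly R[3]}) (h : 'rV[R]_2).
Hypothesis hl : edge_forms D p l.
Hypothesis hslope : forall v w w' : 'I_n, interior_vertex D v ->
  partially_interior D [set v; w] -> totally_interior D [set v; w'] ->
  slope (p v) (p w) <> slope (p v) (p w').

Lemma edge_form_homog e : edge D e -> l e \is 1.-homog.
Proof. by move=> /hl[]. Qed.

Lemma edge_form_vanish e u : edge D e -> u \in e -> (l e).@[lift_point (p u) 0] = 0.
Proof.
move=> he ue; have [_ _ ] := hl he; apply.
exists 1, (p u); split => //; last by rewrite scale1r.
exists (fun i => (i == u)%:R); split.
- by move=> i; rewrite ler0n.
- rewrite (bigD1 u) //= eqxx big1 ?addr0 // => i /andP[_ /negbTE ->] //.
by rewrite (bigD1 u) //= eqxx scale1r big1 ?addr0 // => i /andP[_ /negbTE ->]; rewrite scale0r.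
Qed.

(* The two endpoints of the totally interior edge play the same part; only the
   orientation of h differs. *)
Section Vertex.
Variables v w : 'I_n.
Hypothesis vwE : [set v; w] = [set v1; v2].
Hypothesis hvw : h = p w - p v \/ h = - (p w - p v).

Let vi : interior_vertex D v.
Proof.
have /andP[_ /forall_inP] : totally_interior D [set v; w] by apply/hone.
by apply; rewrite set21.
Qed.

Lemma partial_edge_direction u : u != v -> partially_interior D [set v; u] ->
  p u != p v /\ cross (p u - p v) h != 0.
Proof.
move=> uv pe.
have tot : totally_interior D [set v; w] by apply/hone.
have hw : edge D [set v; w] by case/andP: tot.
have wv : w != v.
  by apply: contraTneq hw => ->; rewrite edgeE cards2 eqxx andbF.
have pu : p u != p v.
  apply: edge_points_neq; first by rewrite eq_sym.
  by case/andP: pe => /andP[].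
have pw : p w != p v.
  by apply: edge_points_neq; [rewrite eq_sym|case/andP: hw].
split => //; have := hslope vi pe tot => /eqP; rewrite slope_eq //.
case: hvw => -> //; apply: contra.
by rewrite /cross !mxE => /eqP E; apply/eqP/oppr_inj; rewrite oppr0 -{}E; ring.
Qed.

Lemma partial_edge_form e : partial_at D v e ->
  dot (grad (l e)) h / dot h h != 0 /\
  l e = (dot (grad (l e)) h / dot h h) *:
        (along h (p v) - cotangent h (l e) *: across h (p v)).
Proof.
move=> /andP[pe ve]; have he : edge D e by case/andP: pe.
have [u uv eE] : exists2 u, u != v & e = [set v; u].
  by apply: set2_of_mem ve; move: he; rewrite edgeE => /andP[].
have [_ dh] : p u != p v /\ cross (p u - p v) h != 0.
  by apply: partial_edge_direction; rewrite // -eE.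
have [l0 lh _] := hl he.
have lv := edge_form_vanish he ve.
have lu : (l e).@[lift_point (p v + (p u - p v)) 0] = 0.
  by rewrite addrC subrK edge_form_vanish // eE set22.
split; last exact: pencil_form dh.
rewrite mulf_neq0 ?invr_neq0 ?(dot_grad_neq0 lh l0 lv lu dh) //.
rewrite dotvv_eq0; apply: contra dh => /eqP ->.
by rewrite /cross !mxE !mulr0 subrr.
Qed.

(** For the edges at [v] that are not parallel to [h], equal cotangents and equal
    slopes both mean parallel edges. *)
Lemma num_values_cotangent :
  num_values (partial_at D v) (fun e => cotangent h (l e)) = num_partial_slopes D p v.
Proof.
rewrite /num_values /num_partial_slopes.
set ws := [seq w <- enum 'I_n | partially_interior D [set v; w]].
have wsP u : u \in ws -> [/\ u != v, partially_interior D [set v; u],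
    p u != p v & cross (p u - p v) h != 0].
  rewrite mem_filter => /andP[pe _].
  have uv : u != v.
    by apply: contraTneq pe => ->; rewrite /partially_interior edgeE cards2 eqxx andbF.
  by have [pu cu] := partial_edge_direction uv pe.
have cotE u : u \in ws -> cotangent h (l [set v; u])
    = - dot (p u - p v) h / cross (p u - p v) h.
  move=> /wsP[uv pe pu cu]; have he : edge D [set v; u] by case/andP: pe.
  have [l0 lh _] := hl he; apply: (cotangentE (q := p v) lh l0 _ _ cu).
    by apply: (edge_form_vanish he); exact: set21.
  by rewrite addrC subrK (edge_form_vanish he) // set22.
transitivity (size (undup [seq cotangent h (l [set v; u]) | u <- ws])).
  apply: perm_size; apply: perm_undup => x; apply/mapP/mapP => -[].
    move=> e; rewrite mem_enum => /andP[pe ve] ->.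
    have [u uv eE] : exists2 u, u != v & e = [set v; u].
      by apply: set2_of_mem ve; case/andP: pe; rewrite edgeE => /andP[].
    by exists u; rewrite ?eE // mem_filter mem_enum -eE pe.
  move=> u uws ->; exists [set v; u] => //.
  by have [_ pe _ _] := wsP u uws; rewrite mem_enum unfold_in /partial_at pe set21.
apply: size_undup_map => u u' uws u'ws; rewrite !cotE //.
have [_ _ pu cu] := wsP u uws; have [_ _ pu' cu'] := wsP u' u'ws.
by rewrite cotangent_eq // slope_eq.
Qed.

Lemma partial_ideal_pencil f : partial_ideal r D l v f <->
  powers_ideal (partial_at D v)
    (fun e => along h (p v) - cotangent h (l e) *: across h (p v)) r f.
Proof.
apply: (powers_ideal_scale (b := fun e => dot (grad (l e)) h / dot h h)) => e.
  by case/partial_edge_form.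
by case/partial_edge_form.
Qed.

End Vertex.
End Star.

(** * The regularity *)

Theorem mainTheorem1 (R : realType) (r n : nat) (D : {set {set 'I_n}})
    (p : 'I_n -> 'rV[R]_2) (l : {set 'I_n} -> {mpoly R[3]}) (v1 v2 : 'I_n)
    (hD : embedded_complex D p)
    (hpure : pure2 D)
    (hconn : connected (realization D p))
    (hgenus : genus0 (realization D p))
    (hslope : forall v w w' : 'I_n, interior_vertex D v ->
      partially_interior D [set v; w] -> totally_interior D [set v; w'] ->
      slope (p v) (p w) <> slope (p v) (p w'))
    (hone : forall e : {set 'I_n}, totally_interior D e <-> e = [set v1; v2])
    (hl : edge_forms D p l)
    (hH0 : exists d : nat, H0_neq0 r D l d) :
  exists2 d : nat, is_reg (H0_neq0 r D l) d &
    (alpha r D p v1 + alpha r D p v2 + r - 1 <= d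
       <= alpha r D p v1 + alpha r D p v2 + r)%N.
Proof.
have lh := edge_form_homog hl.
have he : edge D [set v1; v2] := edge_eps hone.
have eD : [set v1; v2] \in D by case/andP: he.
have e21 : [set v2; v1] = [set v1; v2] by rewrite finset.setUC.
pose h := p v2 - p v1.
have h0 : h != 0 by rewrite subr_eq0 (edge_points_neq hD (eps_neq hone)).
have h1 : h = p v2 - p v1 \/ h = - (p v2 - p v1) by left.
have h2 : h = p v1 - p v2 \/ h = - (p v1 - p v2) by right; rewrite opprB.
have pv2 : p v2 = p v1 + h by rewrite addrC subrK.
pose X := across h (p v1); pose Y := along h (p v1); pose Z := along h (p v1 + h).
pose c e := cotangent h (l e).
have [b b0 lE] : exists2 b, b != 0 & l [set v1; v2] = b *: X.
  have [l0 lhe _] := hl _ he.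
  by apply: axis_form; rewrite // -?pv2 (edge_form_vanish hl he) ?set21 ?set22.
pose J1 := powers_ideal (partial_at D v1) (fun e => Y - c e *: X) r.
pose J2 := powers_ideal (partial_at D v2) (fun e => Z - c e *: X) r.
have J1E f : partial_ideal r D l v1 f <-> J1 f.
  exact: (partial_ideal_pencil r hD hone hl hslope erefl h1).
have J2E f : partial_ideal r D l v2 f <-> J2 f.
  have := partial_ideal_pencil r hD hone hl hslope e21 h2 f.
  by rewrite pv2 across_shift.
have br0 : b ^+ r.+1 != 0 by rewrite expf_neq0.
have glueE g : glue_class r D l v1 v2 g <-> colon_sum J1 J2 (X ^+ r.+1) g.
  rewrite /glue_class lE exprZn.
  split=> -[g1 [g2 [gE g1J g2J]]]; exists g1, g2; split => //.
  - have := powers_idealZ (b ^- r.+1) (iffLR (J1E _) g1J).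
    by rewrite -scalerAr scalerA mulVf ?scale1r.
  - have := powers_idealZ (b ^- r.+1) (iffLR (J2E _) g2J).
    by rewrite -scalerAr scalerA mulVf ?scale1r.
  - by rewrite -scalerAr; apply/J1E; exact: powers_idealZ.
  - by rewrite -scalerAr; apply/J2E; exact: powers_idealZ.
have k1E := num_values_cotangent hD hone hl hslope erefl h1.
have k2E := num_values_cotangent hD hone hl hslope e21 h2.
have k1gt := two_partial_slopes hD hone hpure (v := v1) (w := v2) erefl.
have k2gt := two_partial_slopes hD hone hpure e21.
rewrite /alpha.
move: k1E k2E k1gt k2gt.
set k1 := num_partial_slopes D p v1; set k2 := num_partial_slopes D p v2.
move=> k1E k2E k1gt k2gt.
have glued e : (forall a i j, (a + i + j = e)%N ->
    (r + a + 2 <= k1 * (a + i + 1))%N \/ (r + a + 2 <= k2 * (a + j + 1))%N) ->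
    forall g, g \is e.-homog -> glue_class r D l v1 v2 g.
  move=> cond; apply: (@homog_ind R 3 X Y Z).
  - by move=> i; apply: var_span.
  - exact: colon_sum0.
  - by move=> f g; apply: colon_sumD.
  - by move=> s f; apply: colon_sumZ.
  move=> a i j aij; apply/glueE.
  apply: (@monomials_in_colon_sum R {mpoly R[3]} _ (partial_at D v1) (partial_at D v2)
    c c X Y Z r e _ a i j aij).
  by rewrite k1E k2E.
have upper d : H0_neq0 r D l d -> (d < r.+1 %/ k1 + r.+1 %/ k2 + r.+1)%N.
  move=> /(not_glued_of_H0_neq0 hone lh)[e [g [-> hg ng]]].
  rewrite ltn_add2r ltnNge; apply/negP => large; apply: ng.
  by apply: glued hg => a i j aij; apply: slope_condition; rewrite ?aij.
(* If one of the quotients were 0, the module would vanish in all degrees. *)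
have alpha_gt0 : (0 < r.+1 %/ k1)%N /\ (0 < r.+1 %/ k2)%N.
  have [d /(not_glued_of_H0_neq0 hone lh)[e [g [_ hg ng]]]] := hH0.
  have small k a i : (1 < k)%N -> (r.+1 < k)%N -> (r + a + 2 <= k * (a + i + 1))%N.
    by move=> kgt rk; nia.
  rewrite !divn_gt0 ?(ltnW k1gt) ?(ltnW k2gt) //; split; rewrite leqNgt; apply/negP => rk;
    apply: ng; apply: glued hg => a i j _; [left|right]; exact: small.
have lower : H0_neq0 r D l ((r.+1 %/ k1).-1 + (r.+1 %/ k2).-1 + r.+1).
  apply: (H0_neq0_of_not_glued hone lh (g := Y ^+ (r.+1 %/ k1).-1 * Z ^+ (r.+1 %/ k2).-1)).
    by rewrite dhomogM // -[X in X.-homog]mul1n dhomogMn ?along_homog.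
  move/glueE; apply: (@separated_monomial_notin_colon_sum R 3 3 _ _ _ _ _ _ _ _ X Y Z
    (coordinates h (p v1)) (dot h h) 0 1 2) => //.
  - by rewrite dotvv_eq0.
  - exact: comp_across.
  - exact: comp_along.
  - exact: comp_along_shift.
  - rewrite k1E; case: alpha_gt0 => a1 a2; rewrite (prednK a1).
    by rewrite mulnC; exact: leq_divM.
  - rewrite k2E; case: alpha_gt0 => a1 a2; rewrite (prednK a2).
    by rewrite mulnC; exact: leq_divM.
have exH : exists d, `[< H0_neq0 r D l d >].
  by have [d hd] := hH0; exists d; apply/asboolP.
have bounded d : `[< H0_neq0 r D l d >] -> (d <= r.+1 %/ k1 + r.+1 %/ k2 + r.+1)%N.
  by move=> /asboolP /upper /ltnW.
have [d /asboolP hd dmax] := ex_maxnP exH bounded.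
exists d; first by split => // k Hk; apply: dmax; apply/asboolP.
have := dmax _ (introT (asboolP _) lower); have := upper _ hd.
by case: alpha_gt0; lia.
Qed.
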